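(* Let $\Bbbk$ be a field of characteristic zero and let $\mathfrak g_\circ=\bigoplus_{j=1}^6L_j$ be the $14$-dimensional graded Lie algebra over $\Bbbk$ defined in the context. With $H^q_w$ the weight-$w$ part of its adjoint cohomology $H^q(\mathfrak g_\circ;\mathfrak g_\circ)$, $$\dim H^2_w=\begin{cases}19,&w=-2,\\26,&w=-1,\\11,&w=0,\\4,&w=1,\\0,&\text{otherwise},\end{cases}\qquad\dim H^2=60.$$ Moreover, $$\dim H^3_w=\begin{cases}34,&w=-7,\\60,&w=-6,\\62,&w=-5,\\39,&w=-4,\\12,&w=-3,\\2,&w=-2,\\0,&\text{otherwise},\end{cases}\qquad\dim H^3=209.$$
   Context: $\mathfrak g_\circ$ has homogeneous basis $X,Y\in L_1$; $Z_0\in L_2$; $Z_x,Z_y\in L_3$; $Z_{x^2},Z_{xy},Z_{y^2}\in L_4$; $Z_{x^3},Z_{x^2y},Z_{xy^2},Z_{y^3}\in L_5$; $T_0,T_1\in L_6$. The bracket is $[X,Y]=Z_0$, $[X,Z_p]=Z_{xp}$, $[Y,Z_p]=Z_{yp}$ for monomials $p$ in $x,y$ of degree $\le3$ (with $Z_1=Z_0$), where $Z_{x^4}=Z_{y^4}=T_0$, $Z_{x^3y}=Z_{xy^3}=T_1$, $Z_{x^2y^2}=0$; $L_6$ is central and $\bigoplus_{j\ge2}L_j$ is abelian. (It is attached to the pencil of binary quartics spanned by $S^4+T^4$ and $4S^3T+4ST^3$.) $C^q=\operatorname{Hom}(\Lambda^q\mathfrak g_\circ,\mathfrak g_\circ)$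 is the adjoint Chevalley–Eilenberg complex; $C^q_w$ consists of cochains $f$ with $f(L_{i_1},\dots,L_{i_q})\subseteq L_{i_1+\cdots+i_q+w}$ (with $L_j=0$ for $j\notin\{1,\dots,6\}$). The differential preserves weight and $H^q_w$ is the cohomology of $C^\bullet_w$ in degree $q$. *)

(* Defs.v *)
From HB Require Import structures.
From mathcomp Require Import all_boot all_order all_algebra.
From mathcomp Require Import boolp functions.
From mathcomp Require Import ring.

Set Implicit Arguments.
Unset Strict Implicit.
Unset Printing Implicit Defensive.

Import GRing.Theory.
Local Open Scope ring_scope.

(* [dim_quotient Z B n]: the quotient of the subspace Z by the subspace B has
   dimension n, i.e. there are n elements of Z whose classes modulo B form a
   basis of Z / B. *)
Definition dim_quotient (k : fieldType) (W : lmodType k) (Z B : W -> Prop)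
    (n : nat) : Prop :=
  exists e : 'I_n -> W, (forall i, Z (e i)) /\
    forall z, Z z ->
      exists! c : {ffun 'I_n -> k}, B (z - \sum_(i < n) c i *: e i).

Section ChevalleyEilenberg.
Variables (k : fieldType) (V : vectType k) (br : V -> V -> V).

(* Hom(Lambda^q V, V) is encoded as the alternating q-linear maps V^q -> V. *)
Definition cochain (q : nat) : Type := {ffun 'I_q -> V} -> V.

Definition upd q (x : {ffun 'I_q -> V}) (i : 'I_q) (v : V) : {ffun 'I_q -> V} :=
  [ffun l => if l == i then v else x l].

Definition multilinear q (f : cochain q) : Prop :=
  forall (x : {ffun 'I_q -> V}) (i : 'I_q) (a : k) (u v : V),
    f (upd x i (a *: u + v)) = a *: f (upd x i u) + f (upd x i v).

Definition alternating q (f : cochain q) : Prop :=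
  forall (x : {ffun 'I_q -> V}) (i j : 'I_q), i != j -> x i = x j -> f x = 0.

Definition CE_cochain q (f : cochain q) : Prop := multilinear f /\ alternating f.

Definition args q (s : seq V) : {ffun 'I_q -> V} := [ffun l : 'I_q => s`_l].

(* The lists passed to [args] have length exactly q. *)
Definition CE_diff q (f : cochain q) : cochain q.+1 := fun x =>
  \sum_(i < q.+1) (-1) ^+ i *:
     br (x i) (f (args q [seq x l | l <- enum 'I_q.+1 & l != i]))
  + \sum_(i < q.+1) \sum_(j < q.+1 | (i < j)%N) (-1) ^+ (i + j) *:
     f (args q (br (x i) (x j)
          :: [seq x l | l <- enum 'I_q.+1 & (l != i) && (l != j)])).

Variable L : int -> {vspace V}.

Definition CE_cochain_weight (w : int) q (f : cochain q) : Prop :=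
  CE_cochain f /\
  forall (i : 'I_q -> int) (x : {ffun 'I_q -> V}),
    (forall l, x l \in L (i l)) -> f x \in L (\sum_(l < q) i l + w).

(* Cocycles, coboundaries and cohomology of the subcomplex C. *)
Variable C : forall q, cochain q -> Prop.

Definition cocycle q (f : cochain q) : Prop :=
  C f /\ CE_diff f = (fun=> 0).

Definition coboundary q : cochain q -> Prop :=
  match q return cochain q -> Prop with
  | 0 => fun f => f = (fun=> 0)
  | q'.+1 => fun f => exists2 h : cochain q', C h & f = CE_diff h
  end.

Definition dim_cohomology (q n : nat) : Prop :=
  dim_quotient (W := {ffun 'I_q -> V} -> V) (@cocycle q) (@coboundary q) n.

End ChevalleyEilenberg.

(* Zxxy is the basis vector indexed by the monomial x^2 y, and so on. *)
Variant gen := X | Y | Z0 | Zx | Zy | Zxx | Zxy | Zyy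
  | Zxxx | Zxxy | Zxyy | Zyyy | T0 | T1.

Definition gens : seq gen :=
  [:: X; Y; Z0; Zx; Zy; Zxx; Zxy; Zyy; Zxxx; Zxxy; Zxyy; Zyyy; T0; T1].

Definition gen_code (b : gen) : nat :=
  match b with
  | X => 0 | Y => 1 | Z0 => 2 | Zx => 3 | Zy => 4 | Zxx => 5 | Zxy => 6
  | Zyy => 7 | Zxxx => 8 | Zxxy => 9 | Zxyy => 10 | Zyyy => 11 | T0 => 12
  | T1 => 13
  end.

Lemma gen_codeK : cancel gen_code (nth X gens).
Proof. by case. Qed.

HB.instance Definition _ := Countable.copy gen (can_type gen_codeK).

Lemma gens_enum : Finite.axiom gens.
Proof. by case. Qed.

HB.instance Definition _ := isFinite.Build gen gens_enum.

Definition deg (b : gen) : nat :=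
  match b with
  | X | Y => 1
  | Z0 => 2
  | Zx | Zy => 3
  | Zxx | Zxy | Zyy => 4
  | Zxxx | Zxxy | Zxyy | Zyyy => 5
  | T0 | T1 => 6
  end.

Section Algebra.
Variable k : fieldType.

Definition g0 : vectType k := {ffun gen -> k^o}.

Definition bas (b : gen) : g0 := [ffun c => (c == b)%:R].

Definition L (j : int) : {vspace g0} :=
  <<[seq bas b | b <- gens & (deg b)%:Z == j]>>%VS.

(* On Z_{x^3}, ..., Z_{y^3} the values are given by
   Z_{x^4} = Z_{y^4} = T0, Z_{x^3 y} = Z_{x y^3} = T1, Z_{x^2 y^2} = 0. *)
Definition adX (b : gen) : g0 :=
  match b with
  | Y => bas Z0
  | Z0 => bas Zx
  | Zx => bas Zxx | Zy => bas Zxy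
  | Zxx => bas Zxxx | Zxy => bas Zxxy | Zyy => bas Zxyy
  | Zxxx => bas T0 | Zxxy => bas T1 | Zxyy => 0 | Zyyy => bas T1
  | X | T0 | T1 => 0
  end.

Definition adY (b : gen) : g0 :=
  match b with
  | X => - bas Z0
  | Z0 => bas Zy
  | Zx => bas Zxy | Zy => bas Zyy
  | Zxx => bas Zxxy | Zxy => bas Zxyy | Zyy => bas Zyyy
  | Zxxx => bas T1 | Zxxy => 0 | Zxyy => bas T1 | Zyyy => bas T0
  | Y | T0 | T1 => 0
  end.

Definition bracket_gen (a b : gen) : g0 :=
  match a, b with
  | X, _ => adX b
  | Y, _ => adY b
  | _, X => - adX a
  | _, Y => - adY a
  | _, _ => 0
  end.

Definition bracket (u v : g0) : g0 :=
  \sum_a \sum_b ((u a : k) * v b) *: bracket_gen a b.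

Lemma bracketE (u v : g0) (c : gen) : bracket u v c =
  let wX b := (u X : k) * v b - u b * v X in
  let wY b := (u Y : k) * v b - u b * v Y in
  match c with
  | X | Y => 0
  | Z0 => wX Y
  | Zx => wX Z0 | Zy => wY Z0
  | Zxx => wX Zx | Zxy => wX Zy + wY Zx | Zyy => wY Zy
  | Zxxx => wX Zxx | Zxxy => wX Zxy + wY Zxx
  | Zxyy => wX Zyy + wY Zxy | Zyyy => wY Zyy
  | T0 => wX Zxxx + wY Zyyy
  | T1 => wX Zxxy + wX Zyyy + wY Zxxx + wY Zxyy
  end.
Proof.
rewrite /bracket !sum_ffunE.
under eq_bigr => a _ do rewrite sum_ffunE.
under eq_bigr => a _ do under eq_bigr => b _ do rewrite ffunE.
rewrite /index_enum !unlock /= /GRing.scale /=.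
by case: c; rewrite !ffunE /=; ring.
Qed.

Lemma bracketvv (u : g0) : bracket u u = 0.
Proof. by apply/ffunP=> c; rewrite bracketE ffunE; case: c => /=; ring. Qed.

Lemma bracket_jacobi (u v w : g0) :
  bracket u (bracket v w) + bracket v (bracket w u) + bracket w (bracket u v)
  = 0.
Proof.
by apply/ffunP=> c; rewrite !ffunE !bracketE; case: c => /=; rewrite ?bracketE /=; ring.
Qed.

Definition dim_H (q n : nat) : Prop :=
  dim_cohomology bracket (@CE_cochain k g0) q n.

Definition dim_Hw (q : nat) (w : int) (n : nat) : Prop :=
  dim_cohomology bracket (@CE_cochain_weight k g0 L w) q n.

End Algebra.

(* Main.v *)
From HB Require Import structures.
Require Import Defs.
From Stdlib Require BinPos BinInt FMapPositive.
From mathcomp Require Import all_boot all_order all_algebra all_fingroup.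
From mathcomp Require Import boolp functions ssrZ ring.

(* A cochain of degree q is determined by its coefficients on the pairs (S, b),
   where S is a strictly increasing q-tuple of basis vectors and b a basis
   vector, and these coefficients are arbitrary: the minors det (x_i(S_j)) b
   form the dual basis.  In these coordinates the differential is an integer
   matrix D_q which respects weights, so that in each weight
     dim H^q = #{(S, b)} - rank D_q - rank D_(q-1).
   The ranks are found by sparse fraction-free elimination over Z; since every
   row operation multiplies a row by a nonzero integer and the pivots are
   nonzero integers, they are the same over every field of characteristic 0. *)

Set Implicit Arguments.
Unset Strict Implicit.
Unset Printing Implicit Defensive.

Import GRing.Theory.
Import Corelib.Numbers.BinNums(positive, xI, xO, xH, Z, Zpos, Zneg).

(** * Integer coefficients of the differential *)

(** Coefficients determine a map only among alternating multilinear maps, so d f must be known to be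
    alternating before it can be replaced with a vector; this is proved for an abstract bracket with
    [u, u] = 0, over a field where 2 is nonzero. In contrast, d d = 0 is read off from the integer
    coefficients in the degrees that matter. The ranks are computed once, with no field in sight;
    the field enters afterwards, through the interpretation of sparse rows as vectors. A predicate
    on the pairs (S, b) that the differential respects selects a subcomplex: fixing the weight gives
    the graded pieces, and the constant predicate gives the whole cohomology, whose dimension is
    thus computed directly and not by summing over the weights. Outside a finite window of weights
    there are no pairs at all. *)

(* [(S, b)] stands for the coefficient of a cochain at b on the tuple S. *)
Definition key := (seq gen * gen)%type.

(* Digits decrease from X to T1: together with the output vector as leading digit
   in [key_code], this ordering of the coordinates gives little fill-in during
   the elimination. *)
Definition push_gen (p : positive) (b : gen) : positive :=
  match b with
  | X => xO (xI (xI (xI p))) | Y => xI (xO (xI (xI p)))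
  | Z0 => xO (xO (xI (xI p))) | Zx => xI (xI (xO (xI p)))
  | Zy => xO (xI (xO (xI p))) | Zxx => xI (xO (xO (xI p)))
  | Zxy => xO (xO (xO (xI p))) | Zyy => xI (xI (xI (xO p)))
  | Zxxx => xO (xI (xI (xO p))) | Zxxy => xI (xO (xI (xO p)))
  | Zxyy => xO (xO (xI (xO p))) | Zyyy => xI (xI (xO (xO p)))
  | T0 => xO (xI (xO (xO p))) | T1 => xI (xO (xO (xO p)))
  end.

Definition key_code (t : key) : positive := foldl push_gen (push_gen xH t.2) t.1.

Definition gen_lt (a b : gen) : bool := BinPos.Pos.ltb (push_gen xH b) (push_gen xH a).

(** The bracket of two basis vectors is never a proper sum: it is zero or a basis vector up to sign,
    so an option suffices. *)
Definition ad_X (b : gen) : option gen :=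
  match b with
  | Y => Some Z0 | Z0 => Some Zx | Zx => Some Zxx | Zy => Some Zxy
  | Zxx => Some Zxxx | Zxy => Some Zxxy | Zyy => Some Zxyy
  | Zxxx => Some T0 | Zxxy => Some T1 | Zyyy => Some T1
  | _ => None
  end.
(** [X] falls under [None] although [Y, X] = - Z0: [gen_bracket] treats that pair on its own. *)
Definition ad_Y (b : gen) : option gen :=
  match b with
  | Z0 => Some Zy | Zx => Some Zxy | Zy => Some Zyy
  | Zxx => Some Zxxy | Zxy => Some Zxyy | Zyy => Some Zyyy
  | Zxxx => Some T1 | Zxyy => Some T1 | Zyyy => Some T0
  | _ => None
  end.
(* In the pairs below the boolean is the sign, [true] for minus. *)
Definition signed (s : bool) (o : option gen) : option (bool * gen) :=
  if o is Some c then Some (s, c) else None.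
Definition gen_bracket (a b : gen) : option (bool * gen) :=
  match a, b with
  | Y, X => Some (true, Z0)
  | X, _ => signed false (ad_X b)
  | Y, _ => signed false (ad_Y b)
  | _, X => signed true (ad_X a)
  | _, Y => signed true (ad_Y a)
  | _, _ => None
  end.

(** A repeated entry gives [None], since an alternating map vanishes on it; otherwise the boolean is
    the parity of the number of entries passed. *)
Fixpoint insert_gen (g : gen) (s : seq gen) : option (bool * seq gen) :=
  match s with
  | [::] => Some (false, [:: g])
  | h :: s' =>
    if gen_lt g h then Some (false, g :: s)
    else if gen_lt h g then
      if insert_gen g s' is Some (e, u) then Some (~~ e, h :: u) else None
    else None
  end.

Definition gen_eqb (a b : gen) : bool := BinPos.Pos.eqb (push_gen xH a) (push_gen xH b).
Definition del (T : seq gen) (p : pred nat) :=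
  [seq nth X T l | l <- iota 0 (size T) & p l].
Definition signZ (e : bool) : Z := if e then Zneg xH else Zpos xH.

Definition diff_coefs_act (T : seq gen) (c : gen) (i : nat) : seq (key * Z) :=
  flatten [seq if gen_bracket (nth X T i) b is Some (e, d) then
     if gen_eqb d c then [:: ((del T (fun l => l != i), b), signZ (odd i (+) e))]
     else [::] else [::] | b <- gens].
Definition diff_coefs_br (T : seq gen) (c : gen) (i j : nat) : seq (key * Z) :=
  if gen_bracket (nth X T i) (nth X T j) is Some (e, d) then
    if insert_gen d (del T (fun l => (l != i) && (l != j))) is Some (e', u) then
      [:: ((u, c), signZ (odd (i + j) (+) (e (+) e')))]
    else [::] else [::].
(* The pairs (s, c) such that the coefficient of the differential of f at t is
   the sum of the c times the coefficient of f at s; see [coef_diff]. *)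
Definition diff_coefs (t : key) : seq (key * Z) :=
  flatten [seq diff_coefs_act t.1 t.2 i | i <- iota 0 (size t.1)] ++
  flatten [seq flatten [seq diff_coefs_br t.1 t.2 i j | j <- iota 0 (size t.1) & i < j]
    | i <- iota 0 (size t.1)].

(** * Sparse elimination over the integers *)

Definition srow := seq (positive * Z).

(** A merge by increasing key, dropping entries that cancel. The inner [aux] recurses on the second
    row while the outer function recurses on the first. *)
Fixpoint lincomb (a : Z) (p : srow) (b : Z) {struct p} : srow -> srow :=
  if p is (i, x) :: p' then
    fix aux (r : srow) : srow :=
      if r is (j, y) :: r' then
        match BinPos.Pos.compare i j with
        | Lt => (i, BinInt.Z.mul a x) :: lincomb a p' b r
        | Gt => (j, BinInt.Z.mul b y) :: aux r'
        | Eq =>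
          match BinInt.Z.add (BinInt.Z.mul a x) (BinInt.Z.mul b y) with
          | BinNums.Z0 => lincomb a p' b r'
          | z => (i, z) :: lincomb a p' b r'
          end
        end
      else [seq (t.1, BinInt.Z.mul a t.2) | t <- p]
  else fun r => [seq (t.1, BinInt.Z.mul b t.2) | t <- r].

(* Dividing by the gcd of the two leading coefficients is essential: without it
   the entries reach millions of bits. *)
Definition eliminate (p r : srow) : srow :=
  match p, r with
  | (_, a) :: _, (_, b) :: _ =>
    let: (_, (a', b')) := BinInt.Z.ggcd a b in
    if BinInt.Z.eqb a' BinNums.Z0 then r else lincomb a' r (BinInt.Z.opp b') p
  | _, _ => r
  end.

Module M := FMapPositive.PositiveMap.

(* Exhausting the fuel is harmless: the span stays correct, and [sparse_rank]
   checks the pivots afterwards. *)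
Fixpoint reduce (fuel : nat) (m : M.t srow) (r : srow) : srow :=
  match fuel, r with
  | n.+1, (k, _) :: _ =>
    if M.find k m is Some p then reduce n m (eliminate p r) else r
  | _, _ => r
  end.

(** The table serves to find the pivot row with a given leading key, the list to recover all rows
    kept. *)
Definition insert_row (st : M.t srow * seq srow) (r : srow) : M.t srow * seq srow :=
  if reduce 1000 st.1 r is (k, z) :: r' then
    (M.add k ((k, z) :: r') st.1, ((k, z) :: r') :: st.2)
  else st.

Definition echelon (rs : seq srow) : seq srow :=
  (foldl insert_row (M.empty srow, [::]) rs).2.

Definition keylt (s t : positive * Z) := BinPos.Pos.ltb s.1 t.1.
Definition lead (r : srow) : positive := (head (xH, BinNums.Z0) r).1.
Definition leadle (r s : srow) := BinPos.Pos.leb (lead r) (lead s).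
Definition leadlt (r s : srow) := BinPos.Pos.ltb (lead r) (lead s).

Definition pivot_ok (r : srow) : bool :=
  if r is (_, z) :: _ then ~~ BinInt.Z.eqb z BinNums.Z0 && sorted keylt r else false.

(** Adding the terms as rows with one entry both sorts them by code and cancels equal keys. *)
Definition normalize (s : seq (key * Z)) : srow :=
  foldr (fun t r => lincomb (Zpos xH) [:: (key_code t.1, t.2)] (Zpos xH) r) [::] s.

(* Nothing about the order of the entries is proved: the echelon form is checked
   on the result.  Short rows first keeps the fill-in small. *)
Definition sparse_rank (rs : seq srow) : option nat :=
  let P := sort leadle (echelon (sort (fun r s => size r <= size s) rs)) in
  if sorted leadlt P && all pivot_ok P then Some (size P) else None.

(** * Enumeration of the coordinates and finite checks *)

Fixpoint combs (q : nat) (l : seq gen) : seq (seq gen) :=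
  match q, l with
  | 0, _ => [:: [::]]
  | _.+1, [::] => [::]
  | q'.+1, a :: l' => [seq a :: s | s <- combs q' l'] ++ combs q l'
  end.
Definition allkeys q : seq key := [seq (s, b) | s <- combs q gens, b <- gens].

Definition degZ (b : gen) : Z :=
  match b with X | Y => Zpos xH | Z0 => Zpos (xO xH) | Zx | Zy => Zpos (xI xH)
  | Zxx | Zxy | Zyy => Zpos (xO (xO xH))
  | Zxxx | Zxxy | Zxyy | Zyyy => Zpos (xI (xO xH)) | T0 | T1 => Zpos (xO (xI xH))
  end.
Definition weight (t : key) : Z :=
  foldr (fun b z => BinInt.Z.sub z (degZ b)) (degZ t.2) t.1.

Definition diff_rank (K : seq key) := sparse_rank [seq normalize (diff_coefs t) | t <- K].

(** The coefficient of d (d f) at [t] is expanded in the coefficients of f; an empty normal form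
    means that everything cancels. *)
Definition dd_ok (K : seq key) : bool :=
  all (fun t => nilp (normalize (flatten
    [seq [seq (u.1, BinInt.Z.mul s.2 u.2) | u <- diff_coefs s.1] | s <- diff_coefs t]))) K.
Definition weight_ok (K : seq key) : bool :=
  all (fun t => all (fun s => BinInt.Z.eqb (weight s.1) (weight t)) (diff_coefs t)) K.
(* The weights -17, ..., 6. *)
Definition weights : seq Z :=
  [seq BinInt.Z.sub (BinInt.Z.of_nat n) (BinInt.Z.of_nat 17) | n <- iota 0 24].

Local Open Scope ring_scope.

(** * Alternating maps and the differential *)

Section AlternatingMaps.
Variables (k : fieldType) (V : vectType k).
Implicit Types (s : seq V) (x : V).

Lemma args_map n (x : {ffun 'I_n -> V}) : args n [seq x l | l <- enum 'I_n] = x.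
Proof.
by apply/ffunP=> i; rewrite ffunE (nth_map i) ?size_enum_ord // nth_ord_enum.
Qed.

(** Multilinearity is stated with [upd], whereas the differential and the sorting of tuples produce
    lists; this passes between the two. The entry [y] is a placeholder. *)
Lemma args_cat_upd q s1 s2 x y (h : (size s1 < q)%N) :
  args q (s1 ++ x :: s2) = upd (args q (s1 ++ y :: s2)) (Ordinal h) x.
Proof.
apply/ffunP=> l; rewrite !ffunE; case: eqP => [->|ne].
  by rewrite /= nth_cat ltnn subnn.
rewrite !nth_cat; case: ltnP => // le.
have : (0 < l - size s1)%N.
  rewrite subn_gt0 ltn_neqAle le andbT; apply/eqP => e.
  by apply: ne; apply: val_inj.
by case: (_ - _)%N.
Qed.

Lemma multilinear_args q (f : cochain V q) (fM : multilinear f) s1 s2 a u v :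
  (size s1 + size s2).+1 = q ->
  f (args q (s1 ++ (a *: u + v) :: s2)) =
    a *: f (args q (s1 ++ u :: s2)) + f (args q (s1 ++ v :: s2)).
Proof.
move=> sz; have h : (size s1 < q)%N by rewrite -sz ltnS leq_addr.
by rewrite (args_cat_upd s2 _ 0 h) fM -!args_cat_upd.
Qed.

Lemma multilinear_args0 q (f : cochain V q) (fM : multilinear f) s1 s2 :
  (size s1 + size s2).+1 = q -> f (args q (s1 ++ 0 :: s2)) = 0.
Proof.
(* With scalar -1 and both vectors zero, linearity reads f 0 = - f 0 + f 0. *)
move=> sz; have := multilinear_args fM (-1) 0 0 sz.
by rewrite scaler0 addr0 scaleN1r addNr.
Qed.

Lemma multilinear_argsZ q (f : cochain V q) (fM : multilinear f) s1 s2 a u :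
  (size s1 + size s2).+1 = q ->
  f (args q (s1 ++ (a *: u) :: s2)) = a *: f (args q (s1 ++ u :: s2)).
Proof.
move=> sz; have := multilinear_args fM a u 0 sz.
by rewrite addr0 multilinear_args0 // addr0.
Qed.

Lemma multilinear_argsD q (f : cochain V q) (fM : multilinear f) s1 s2 u v :
  (size s1 + size s2).+1 = q ->
  f (args q (s1 ++ (u + v) :: s2)) =
    f (args q (s1 ++ u :: s2)) + f (args q (s1 ++ v :: s2)).
Proof. by move=> sz; have := multilinear_args fM 1 u v sz; rewrite !scale1r. Qed.

Lemma multilinear_args_sum q (f : cochain V q) (fM : multilinear f) s1 s2
    (I : Type) (r : seq I) (F : I -> V) :
  (size s1 + size s2).+1 = q ->
  f (args q (s1 ++ (\sum_(i <- r) F i) :: s2)) =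
    \sum_(i <- r) f (args q (s1 ++ F i :: s2)).
Proof.
move=> sz; elim: r => [|i r IHr]; first by rewrite !big_nil multilinear_args0.
by rewrite !big_cons multilinear_argsD // IHr.
Qed.

Lemma alternating_args q (f : cochain V q) (fA : alternating f) s :
  size s = q -> ~~ uniq s -> f (args q s) = 0.
Proof.
move=> sz /(uniqPn 0) [i [j [ij jq e]]]; rewrite sz in jq.
have iq := ltn_trans ij jq.
apply: (fA _ (Ordinal iq) (Ordinal jq)); last by rewrite !ffunE.
by rewrite -val_eqE /= ltn_eqF.
Qed.

Lemma not_uniq_repeat s1 s2 s3 u : ~~ uniq (s1 ++ u :: s2 ++ u :: s3).
Proof.
rewrite cat_uniq /= mem_cat inE eqxx orbT /=.
by apply/negP=> /and3P[].
Qed.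

(** Expand the vanishing value at u + v, u + v; the two terms with equal entries drop out. *)
Lemma alternating_swap q (f : cochain V q) (fC : CE_cochain f) s1 s2 u v :
  (size s1 + size s2).+2 = q ->
  f (args q (s1 ++ u :: v :: s2)) = - f (args q (s1 ++ v :: u :: s2)).
Proof.
case: fC => fM fA sz.
have sz1 w : (size (s1 ++ [:: w]) + size s2).+1 = q.
  by rewrite size_cat /= addn1 addSn.
have sz2 w : (size s1 + size (w :: s2)).+1 = q by rewrite /= addnS.
have szs a b : size (s1 ++ a :: b :: s2) = q by rewrite size_cat /= !addnS.
have nu a : f (args q (s1 ++ a :: a :: s2)) = 0.
  by apply: alternating_args => //; apply: (not_uniq_repeat _ [::]).
have E w : f (args q (s1 ++ w :: (u + v) :: s2)) =
    f (args q (s1 ++ w :: u :: s2)) + f (args q (s1 ++ w :: v :: s2)).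
  by have := multilinear_argsD fM u v (sz1 w); rewrite -!catA.
have := nu (u + v); rewrite multilinear_argsD // !E !nu add0r addr0.
by move/eqP; rewrite addr_eq0 => /eqP.
Qed.

Lemma upd_id n (x : {ffun 'I_n -> V}) i : upd x i (x i) = x.
Proof. by apply/ffunP=> l; rewrite ffunE; case: eqP => [->|]. Qed.

Lemma updC n (x : {ffun 'I_n -> V}) i j u v :
  i != j -> upd (upd x i u) j v = upd (upd x j v) i u.
Proof.
move=> ij; apply/ffunP=> l; rewrite !ffunE.
by case: eqP => // ->; rewrite eq_sym (negPf ij).
Qed.

(** Induction on the distance of the equal entries: exchanging the right one with its left neighbour
    brings them one step closer, and vanishing on adjacent equal entries makes that exchange a
    change of sign. *)
Lemma adjacent_alternating n (g : cochain V n) : multilinear g ->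
  (forall (x : {ffun 'I_n -> V}) (i j : 'I_n), j = i.+1 :> nat -> x i = x j -> g x = 0) ->
  alternating g.
Proof.
move=> gM gadj.
have main d (x : {ffun 'I_n -> V}) (i j : 'I_n) :
    (j = i + d.+1 :> nat)%N -> x i = x j -> g x = 0.
  elim: d x j => [|d IHd] x j eij exx; first by apply: (gadj x i j); rewrite // eij addn1.
  have lt : (i + d.+1 < n)%N by rewrite (leq_ltn_trans _ (ltn_ord j)) // eij leq_add2l.
  pose j' := Ordinal lt.
  have j'j : j' != j by rewrite -val_eqE /= eij eqn_add2l ltn_eqF.
  have ij' : i != j' by rewrite -val_eqE /= -[X in X == _]addn0 eqn_add2l.
  have ij : i != j by rewrite -val_eqE /= eij -[X in X == _]addn0 eqn_add2l.
  pose G u v := g (upd (upd x j' u) j v).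
  have GD u v w : G (u + v) w = G u w + G v w.
    rewrite /G !(updC x _ _ j'j) -[u]scale1r gM !scale1r //.
  have GD' u v w : G w (u + v) = G w u + G w v.
    by rewrite /G -[u]scale1r gM !scale1r.
  have G0 u : G u u = 0.
    apply: (gadj _ j' j); first by rewrite /= eij !addnS.
    by rewrite !ffunE !eqxx (negPf j'j).
  have := G0 (x j' + x j); rewrite GD !GD' !G0 add0r addr0 /G.
  rewrite upd_id upd_id => /eqP; rewrite addr_eq0 => /eqP->.
  rewrite (IHd _ j') ?oppr0 //.
  by rewrite !ffunE (negPf ij) (negPf ij') (negPf j'j) eqxx.
move=> x i j ij e; case: (ltngtP i j) => lt.
- by apply: (main (j - i).-1 x i j) => //; rewrite prednK ?subn_gt0 // subnKC // ltnW.
- by apply: (main (i - j).-1 x j i) => //; rewrite prednK ?subn_gt0 // subnKC // ltnW.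
- by case/eqP: ij; apply: val_inj.
Qed.

End AlternatingMaps.

Lemma enum_ord_split n (i : 'I_n) :
  exists s1 s2, [/\ enum 'I_n = s1 ++ i :: s2, i \notin s1 & i \notin s2].
Proof.
have := enum_uniq 'I_n; have := mem_enum 'I_n i.
case: (splitPr (mem_enum 'I_n i)) => s1 s2 _.
rewrite cat_uniq /= => /and4P[_ h2 h3 _]; exists s1, s2; split => //.
by case/norP: h2.
Qed.

Lemma enum_ord_split2 n (i j : 'I_n) : j = i.+1 :> nat ->
  exists s1 s2, enum 'I_n = s1 ++ [:: i, j & s2] /\
    {in s1 ++ s2, forall l, (l != i) && (l != j)}.
Proof.
move=> ij; have iE : i.+1 = j by [].
have sz := size_enum_ord n.
have E : enum 'I_n = take i (enum 'I_n) ++ [:: i, j & drop j.+1 (enum 'I_n)].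
  rewrite -{1}(cat_take_drop i (enum 'I_n)) (drop_nth i) ?sz // nth_ord_enum.
  by rewrite iE (drop_nth i) ?sz // nth_ord_enum.
exists (take i (enum 'I_n)), (drop j.+1 (enum 'I_n)); split => //.
move=> l ls; have := enum_uniq 'I_n; rewrite {1}E.
rewrite -[[:: i, j & _]]/([:: i; j] ++ _) uniq_catCA cat_uniq => /and3P[_ /hasPn h _].
by have := h l ls; rewrite !inE negb_or.
Qed.

Lemma size_filter_enum (T : finType) (P : pred T) :
  size [seq l <- enum T | P l] = #|P|.
Proof. by rewrite size_filter -sum1_count big_enum_cond sum1_card. Qed.

(** * The differential preserves alternating multilinear maps *)

Section Differential.
Variables (k : fieldType) (V : vectType k) (br : V -> V -> V).
Hypothesis brDl : forall a u v w, br (a *: u + v) w = a *: br u w + br v w.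
Hypothesis brDr : forall a u v w, br w (a *: u + v) = a *: br w u + br w v.
Hypothesis brvv : forall u, br u u = 0.
Hypothesis two_neq0 : 2%:R != 0 :> k.

Definition lin (h : V -> V) := forall a u v, h (a *: u + v) = a *: h u + h v.

Lemma lin_sum (I : Type) (r : seq I) (P : pred I) (F : I -> V -> V) :
  (forall i, P i -> lin (F i)) -> lin (fun u => \sum_(i <- r | P i) F i u).
Proof.
move=> FL a u v; rewrite scaler_sumr -big_split /=.
by apply: eq_bigr => i /FL ->.
Qed.

Lemma linD h1 h2 : lin h1 -> lin h2 -> lin (fun u => h1 u + h2 u).
Proof. by move=> l1 l2 a u v; rewrite l1 l2 scalerDr addrACA. Qed.

Lemma linZ c h : lin h -> lin (fun u => c *: h u).
Proof. by move=> l a u v; rewrite l scalerDr !scalerA mulrC. Qed.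

Lemma map_upd n (x : {ffun 'I_n -> V}) i w (s : seq 'I_n) :
  i \notin s -> [seq upd x i w l | l <- s] = [seq x l | l <- s].
Proof.
move=> ns; apply/eq_in_map => l ls; rewrite ffunE.
by case: eqP => // e; rewrite -e ls in ns.
Qed.

Lemma lin_args q n (f : cochain V q) (fM : multilinear f) (x : {ffun 'I_n -> V})
    (i : 'I_n) (p : seq V) (P : pred 'I_n) :
  P i -> (size p + #|P|)%N = q ->
  lin (fun w => f (args q (p ++ [seq upd x i w l | l <- enum 'I_n & P l]))).
Proof.
move=> Pi sz; have [s1 [s2 [E n1 n2]]] := enum_ord_split i.
have Ew w : p ++ [seq upd x i w l | l <- enum 'I_n & P l] =
   (p ++ [seq x l | l <- s1 & P l]) ++ w :: [seq x l | l <- s2 & P l].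
  rewrite E filter_cat /= Pi map_cat /= ffunE eqxx catA.
  by rewrite !map_upd // mem_filter negb_and ?n1 ?n2 orbT.
move=> a u v; rewrite !Ew multilinear_args //.
rewrite -sz -size_filter_enum E filter_cat /= Pi !size_cat /= !size_map.
by rewrite addnS addnS addnA.
Qed.

Lemma card_pred2C q (i j : 'I_q.+1) : i != j ->
  (1 + #|[pred l | (l != i) && (l != j)]|)%N = q.
Proof.
move=> ij; apply/succn_inj; rewrite -[RHS](card_ord q.+1) -(cardC (pred2 i j)).
rewrite card2 ij !addSn !add0n; do 2 congr (_.+1).
by apply: eq_card => l; rewrite !inE negb_or.
Qed.

(** In each summand the varied argument occurs exactly once: directly in the bracket if its index is
    omitted from the list, and in that list otherwise. *)
Lemma CE_diff_multilinear q (f : cochain V q) :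
  multilinear f -> multilinear (CE_diff br f).
Proof.
move=> fM x i0; apply: linD.
  apply: lin_sum => i _; apply: linZ.
  have [->|ne] := eqVneq i i0.
    move=> a u v; rewrite !ffunE eqxx brDl.
    by rewrite !map_upd // mem_filter eqxx.
  move=> a u v; rewrite !ffunE (negPf ne); rewrite -brDr; congr (br _ _).
  apply: (lin_args fM x (p := [::]) (P := predC1 i)); first by rewrite /= eq_sym.
  by rewrite add0n cardC1 card_ord.
apply: lin_sum => i _; apply: lin_sum => j ij; apply: linZ.
have nij : i != j by rewrite -val_eqE /= ltn_eqF.
have sz := card_pred2C nij.
have szf : (size ([::] : seq V) +
    size [seq x l | l <- enum 'I_q.+1 & (l != i) && (l != j)]).+1 = q.
  by rewrite size_map size_filter_enum.
have [ei|ni] := eqVneq i0 i.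
  subst i0; have nj : j != i by rewrite eq_sym.
  move=> a u v; rewrite !ffunE eqxx (negPf nj) brDl.
  rewrite !map_upd ?mem_filter ?eqxx //.
  exact: (multilinear_args fM (s1 := [::]) a _ _ szf).
have [ej|nj] := eqVneq i0 j.
  subst i0.
  move=> a u v; rewrite !ffunE eqxx (negPf nij) brDr.
  rewrite !map_upd ?mem_filter ?eqxx ?andbF //.
  exact: (multilinear_args fM (s1 := [::]) a _ _ szf).
move=> a u v; rewrite !ffunE ![_ == i0]eq_sym (negPf ni) (negPf nj).
apply: (lin_args fM x (p := [:: br (x i) (x j)])
  (P := [pred l | (l != i) && (l != j)]) _ sz a u v).
by rewrite /= ni nj.
Qed.

Lemma map_repeat_not_uniq n (x : {ffun 'I_n -> V}) (i j : 'I_n) s :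
  i != j -> x i = x j -> i \in s -> j \in s -> ~~ uniq [seq x l | l <- s].
Proof.
move=> ij e si sj; rewrite (perm_uniq (perm_map x (perm_to_rem si))) /= e.
apply/negP=> /andP[/negP h _]; apply: h; apply: map_f.
by move: sj; rewrite (perm_mem (perm_to_rem si)) inE eq_sym (negPf ij).
Qed.

Lemma opp_eq_self0 (v : V) : v = - v -> v = 0.
Proof.
move=> e; have : 2%:R *: v = 0 by rewrite scaler_nat mulr2n {1}e addNr.
by move/eqP; rewrite scaler_eq0 (negPf two_neq0) => /eqP.
Qed.

(* If two adjacent arguments agree, exchanging their indices turns each summand
   of the differential into its opposite. *)
Lemma CE_diff_alternating q (f : cochain V q) :
  CE_cochain f -> alternating (CE_diff br f).
Proof.
move=> [fM fA]; apply: adjacent_alternating; first exact: CE_diff_multilinear.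
move=> x i0 j0 ij exx.
have nij : i0 != j0 by rewrite -val_eqE /= ij neq_ltn leqnn.
have nji : j0 != i0 by rewrite eq_sym.
have [s1 [s2 [E sP]]] := enum_ord_split2 ij.
have sP1 : {in s1, forall l, (l != i0) && (l != j0)}.
  by move=> l ls; apply: sP; rewrite mem_cat ls.
have sP2 : {in s2, forall l, (l != i0) && (l != j0)}.
  by move=> l ls; apply: sP; rewrite mem_cat ls orbT.
have filterE (P Q : pred 'I_q.+1) : ~~ P i0 -> P j0 -> Q i0 -> ~~ Q j0 ->
    (forall l, l != i0 -> l != j0 -> P l = Q l) ->
    [seq x l | l <- enum 'I_q.+1 & P l] = [seq x l | l <- enum 'I_q.+1 & Q l].
  move=> /negPf Pi Pj Qi /negPf Qj PQ; rewrite E !filter_cat /= Pi Pj Qi Qj.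
  rewrite !map_cat /= exx; congr (map x _ ++ _ :: map x _);
    apply: eq_in_filter => l; [move/sP1|move/sP2]; case/andP; exact: PQ.
pose t := tperm i0 j0.
have tP l : l != i0 -> l != j0 -> t l = l by move=> h1 h2; rewrite tpermD // eq_sym.
have ti : t i0 = j0 by rewrite /t tpermL.
have tj : t j0 = i0 by rewrite /t tpermR.
(* No index lies strictly between [i0] and [j0], so every other index compares with both in the same
   way. *)
have ltE l : l != i0 -> l != j0 -> (l < j0)%N = (l < i0)%N.
  by move=> h1 h2; rewrite ij ltnS [LHS]leq_eqVlt val_eqE (negPf h1).
have gtE l : l != i0 -> l != j0 -> (j0 < l)%N = (i0 < l)%N.
  by move=> h1 h2; rewrite ij [RHS]leq_eqVlt -ij eq_sym val_eqE (negPf h2).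
rewrite /CE_diff -[RHS]addr0; congr (_ + _).
- apply: opp_eq_self0; rewrite [LHS](reindex_inj (@perm_inj _ t)) -sumrN.
  apply: eq_bigr => i _.
  have lE : [seq x l | l <- enum 'I_q.+1 & l != i0] =
      [seq x l | l <- enum 'I_q.+1 & l != j0].
    by apply: filterE; rewrite ?eqxx // => l h1 h2; rewrite h1 h2.
  have [->|ni] := eqVneq i i0; first by rewrite ti ij exprS mulN1r scaleNr exx lE.
  have [->|nj] := eqVneq i j0.
    by rewrite tj ij exprS mulN1r scaleNr opprK exx lE.
  (* For every other omitted index, both equal arguments remain in the list and f vanishes. *)
  rewrite tP // alternating_args // ?size_map ?size_filter_enum ?cardC1 ?card_ord //.
    have -> : br (x i) 0 = 0.
      by have := brDr (-1) 0 0 (x i); rewrite scaler0 addr0 scaleN1r addNr.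
    by rewrite scaler0 oppr0.
  by apply: (map_repeat_not_uniq nij exx); rewrite mem_filter mem_enum andbT eq_sym.
(* Extension by zero to all pairs lets each index be moved by the transposition separately. *)
- pose F (i j : 'I_q.+1) := if (i < j)%N then (-1) ^+ (i + j) *: f (args q (br (x i) (x j)
          :: [seq x l | l <- enum 'I_q.+1 & (l != i) && (l != j)])) else 0.
  transitivity (\sum_i \sum_j F i j); first by apply: eq_bigr => i _; rewrite big_mkcond.
  have szf i j : i != j -> size (br (x i) (x j)
      :: [seq x l | l <- enum 'I_q.+1 & (l != i) && (l != j)]) = q.
    by move=> nij'; rewrite -[RHS](card_pred2C nij') /= size_map size_filter_enum.
  have F0 : F i0 j0 = 0.
    rewrite /F; case: ifP => // _; rewrite exx brvv.
    have := szf _ _ nij; rewrite /= => sz.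
    by rewrite (multilinear_args0 fM (s1 := [::]) sz) scaler0.
  (* The arguments agree since [x i0 = x j0]; the sign comes from [j0] being the successor of
     [i0]. *)
  have Fl j : j != i0 -> j != j0 -> F j0 j = - F i0 j.
    move=> nj1 nj2; rewrite /F gtE //; case: ifP => lt; last by rewrite oppr0.
    rewrite ij addSn exprS mulN1r scaleNr exx; congr (- (_ *: f (args q (_ :: _)))).
    apply/esym/filterE; rewrite ?eqxx ?nij ?nji ?(eq_sym _ j) ?nj1 ?nj2 //.
    by move=> l h1 h2; rewrite h1 h2.
  have Fr j : j != i0 -> j != j0 -> F j j0 = - F j i0.
    move=> nj1 nj2; rewrite /F ltE //; case: ifP => lt; last by rewrite oppr0.
    rewrite ij addnS exprS mulN1r scaleNr exx; congr (- (_ *: f (args q (_ :: _)))).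
    apply/esym/filterE; rewrite ?eqxx ?andbF ?nij ?nji ?(eq_sym _ j) ?nj1 ?nj2 //.
    by move=> l h1 h2; rewrite h1 h2 andbC.
  have Fii i : F i i = 0 by rewrite /F ltnn.
  have Fji : F j0 i0 = 0 by rewrite /F ij ltnNge leqnSn.
  apply: opp_eq_self0.
  rewrite [LHS](reindex_inj (@perm_inj _ t)) -sumrN; apply: eq_bigr => i _.
  rewrite [LHS](reindex_inj (@perm_inj _ t)) -sumrN; apply: eq_bigr => j _.
  have [->|ni1] := eqVneq i i0; last have [->|ni2] := eqVneq i j0;
  (have [->|nj1] := eqVneq j i0; last have [->|nj2] := eqVneq j j0);
  rewrite ?ti ?tj ?(tP i) ?(tP j) // ?Fii ?F0 ?Fji ?oppr0 // 1?Fl 1?Fr ?opprK //.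
  rewrite /F; case: ifP => lt; rewrite ?oppr0 //.
  have nij' : i != j by rewrite -val_eqE /= ltn_eqF.
  rewrite alternating_args ?szf ?scaler0 ?oppr0 //=.
  rewrite negb_and (map_repeat_not_uniq nij exx) ?orbT // mem_filter mem_enum andbT.
    by rewrite !(eq_sym i0) ni1 nj1.
  by rewrite !(eq_sym j0) ni2 nj2.
Qed.

End Differential.

(** * Cochains in coordinates *)

Lemma gen_lt_trans : transitive gen_lt. Proof. by case; case; case. Qed.
Lemma gen_lt_irr : irreflexive gen_lt. Proof. by case. Qed.
Lemma gen_lt_total a b : ~~ gen_lt a b -> ~~ gen_lt b a -> a = b.
Proof. by case: a; case: b. Qed.
Lemma gen_eqbE a b : gen_eqb a b = (a == b).
Proof. by apply/idP/eqP => [|->]; [case: a; case: b|case: b]. Qed.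
Lemma sorted_gens : sorted gen_lt gens. Proof. by []. Qed.
Lemma mem_gens a : a \in gens. Proof. by case: a. Qed.

Lemma insert_gen_sorted g s e u : sorted gen_lt s -> insert_gen g s = Some (e, u) ->
  sorted gen_lt u /\ size u = (size s).+1.
Proof.
(* The added clause on lower bounds [h] is what the induction needs when the insertion goes past the
   head. *)
move=> ss; suff H : insert_gen g s = Some (e, u) ->
    (forall h, path gen_lt h s -> gen_lt h g -> path gen_lt h u) /\
    (sorted gen_lt u /\ size u = (size s).+1) by case/H.
elim: s ss e u => [|h s IHs] /= ss e u.
  by case=> _ <-; split=> // h _ /= ->.
case: ifP => [gh [_ <-]|_].
  by split=> /= [h' /andP[_ ->]|]; rewrite gh ?ss // => ->.
case: ifP => // hg; case E: (insert_gen g s) => [[e' u']|] // [_ <-].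
have [H [_ H2]] := IHs (path_sorted ss) _ _ E.
have p := H _ ss hg.
by split=> [h' /= /andP[-> _] _|]; rewrite /= ?H2 p.
Qed.

Section G0.
Variable k : fieldType.
Notation V := (g0 k).
Notation bs := (map (bas k)).

Lemma bas_expand (v : V) : v = \sum_(b <- gens) (v b : k) *: bas k b.
Proof.
apply/ffunP=> c; rewrite sum_ffunE (bigD1_seq c) ?mem_gens //= !ffunE eqxx.
rewrite big1 ?addr0 => [|b bc]; first by rewrite -[LHS]mulr1.
by rewrite !ffunE eq_sym (negPf bc) scaler0.
Qed.

(** The prefix [p] collects the entries already passed, so that each step is a single adjacent
    exchange. *)
Lemma insert_gen_correct q (f : cochain V q) (fC : CE_cochain f) g s p :
  (size p + size s).+1 = q ->
  f (args q (bs p ++ bas k g :: bs s)) =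
    if insert_gen g s is Some (e, u) then (-1) ^+ e *: f (args q (bs p ++ bs u)) else 0.
Proof.
elim: s p => [|h s IHs] p /= sz; first by rewrite scale1r.
case: ifP => [_|gh]; first by rewrite scale1r.
case: ifP => [hg|hg]; last first.
  rewrite (gen_lt_total (negbT gh) (negbT hg)) (alternating_args fC.2) //.
    by rewrite size_cat /= !size_map -sz addnS addnS.
  exact: (not_uniq_repeat _ [::]).
rewrite alternating_swap //; last by rewrite !size_map -sz addnS.
have sz' : (size (rcons p h) + size s).+1 = q by rewrite size_rcons -sz addnS addSn.
have := IHs _ sz'; rewrite map_rcons -cats1 -catA /= => ->.
case: (insert_gen g s) => [[e u]|]; last by rewrite oppr0.
by rewrite -catA -scaleNr; case: e; rewrite /= ?expr1 ?expr0 ?opprK.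
Qed.

Lemma sort_args q (f : cochain V q) (fC : CE_cochain f) s p :
  (size p + size s)%N = q ->
  f (args q (bs p ++ bs s)) = 0 \/
  exists e u, [/\ sorted gen_lt u, size u = size s &
    f (args q (bs p ++ bs s)) = (-1) ^+ (e : bool) *: f (args q (bs p ++ bs u))].
Proof.
elim: s p => [|g s IHs] p /= sz.
  by right; exists false, [::]; rewrite scale1r.
have sz' : (size (rcons p g) + size s)%N = q by rewrite size_rcons -sz addnS addSn.
have := IHs _ sz'; rewrite map_rcons -cats1 -!catA /=.
case=> [->|[e [u [us su ->]]]]; first by left.
rewrite -catA /= insert_gen_correct ?su -?sz ?addnS //.
case E: (insert_gen g u) => [[e' u']|]; last by left; rewrite scaler0.
have [us' su'] := insert_gen_sorted us E.
right; exists (e (+) e'), u'; split; rewrite ?su' ?su //.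
by rewrite scalerA signr_addb.
Qed.

(** Arguments are expanded in the basis one after the other, [p] holding those already replaced; the
    resulting tuple of basis vectors is then sorted. *)
Lemma cochain_eq0 q (f : cochain V q) : CE_cochain f ->
  (forall s, sorted gen_lt s -> size s = q -> f (args q (bs s)) = 0) ->
  f = fun=> 0.
Proof.
move=> fC f0.
have main (s : seq V) p : (size p + size s)%N = q -> f (args q (bs p ++ s)) = 0.
  elim: s p => [|v s IHs] p sz.
    rewrite addn0 in sz; rewrite cats0 -[bs p]/(bs [::] ++ bs p).
    have [//|[e [u [us su ->]]]] := sort_args fC (p := [::]) sz.
    by rewrite (f0 _ us) ?su // scaler0.
  have szp : (size (bs p) + size s).+1 = q by rewrite size_map -sz addnS.
  rewrite (bas_expand v) (multilinear_args_sum fC.1) // big1 // => b _.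
  rewrite (multilinear_argsZ fC.1) //.
  by rewrite -cat_rcons -map_rcons IHs ?scaler0 // size_rcons -sz addnS.
apply: funext => x; rewrite -[x]args_map; apply: (main _ [::]).
by rewrite size_map size_enum_ord.
Qed.

Definition coef q (f : cochain V q) (t : key) : k :=
  f (args q (bs t.1)) t.2.

Definition valid q (t : key) := (size t.1 == q) && sorted gen_lt t.1.

Lemma cochain_coef0 q (f : cochain V q) : CE_cochain f ->
  (forall t, valid q t -> coef f t = 0) -> f = fun=> 0.
Proof.
move=> fC f0; apply: cochain_eq0 => // s ss sz; apply/ffunP=> b.
by have := f0 (s, b); rewrite /valid sz eqxx ss ffunE /coef => ->.
Qed.

Definition minor q (t : key) : cochain V q := fun x =>
  \det (\matrix_(i < q, j < q) (x i (nth X t.1 j) : k)) *: bas k t.2.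
Arguments minor : clear implicits.

Lemma minor_cochain q t : CE_cochain (minor q t).
Proof.
split=> [x i a u v|x i j ij e].
  rewrite /minor scalerA -scalerDl; congr (_ *: _).
  rewrite -[X in _ = _ + X]mul1r; apply: (determinant_multilinear (i0 := i)).
  - by apply/rowP=> j; rewrite !mxE !ffunE eqxx mul1r !ffunE.
  - by apply/matrixP=> i' j; rewrite !mxE !ffunE eq_sym (negPf (neq_lift _ _)).
  - by apply/matrixP=> i' j; rewrite !mxE !ffunE eq_sym (negPf (neq_lift _ _)).
rewrite /minor (determinant_alternate ij) ?scale0r // => l.
by rewrite !mxE e.
Qed.

Lemma sorted_gen_lt_eq s1 s2 : sorted gen_lt s1 -> sorted gen_lt s2 -> s1 =i s2 -> s1 = s2.
Proof. exact: (irr_sorted_eq gen_lt_trans gen_lt_irr). Qed.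

Lemma sorted_gen_lt_uniq s : sorted gen_lt s -> uniq s.
Proof. exact: (sorted_uniq gen_lt_trans gen_lt_irr). Qed.

(** For equal tuples the matrix is the identity. Distinct increasing tuples of the same length
    differ as sets, so some entry of [s'] is missing from [s] and its row is zero. *)
Lemma coef_minor q t t' : valid q t -> valid q t' ->
  coef (minor q t) t' = (t == t')%:R.
Proof.
case: t t' => [s b] [s' b'] /andP[/= /eqP sz ss] /andP[/= /eqP sz' ss'].
rewrite /coef /minor /= ffunE ffunE xpair_eqE (eq_sym b).
rewrite -[RHS]/((_ && _)%:R) -mulnb natrM; congr (_ * _).
have [<-{s' sz' ss'}|ne] := eqVneq s s'.
  rewrite -[RHS](det1 k q); congr (\det _); apply/matrixP=> i j; rewrite !mxE !ffunE.
  rewrite (nth_map X) ?sz // ffunE nth_uniq ?sz ?sorted_gen_lt_uniq //.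
  by rewrite eq_sym.
have [i iN] : exists i : 'I_q, nth X s' i \notin s.
  apply/existsP; apply: contraR ne; rewrite negb_exists => /forallP h.
  apply/eqP/sorted_gen_lt_eq => //; have us := sorted_gen_lt_uniq ss'.
  apply: fsym; apply: (uniq_min_size us _ _).2 => //; last by rewrite sz sz'.
  move=> c /(nthP X) [i]; rewrite sz' => lt <-.
  by have := h (Ordinal lt); rewrite negbK.
rewrite (expand_det_row _ i) big1 // => j _.
rewrite !mxE !ffunE (nth_map X) ?sz' // ffunE.
case: eqP => [e|]; last by rewrite mul0r.
by move: iN; rewrite -e mem_nth ?sz.
Qed.

Lemma CE_cochain_lin q (f g : cochain V q) a :
  CE_cochain f -> CE_cochain g -> CE_cochain (fun x => a *: f x + g x).
Proof.
move=> [fM fA] [gM gA]; split=> [x i b u v|x i j ij e].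
  by rewrite fM gM !scalerDr !scalerA (mulrC a) addrACA.
by rewrite (fA _ _ _ ij e) (gA _ _ _ ij e) scaler0 addr0.
Qed.

Lemma CE_cochain0 q : CE_cochain ((fun=> 0) : cochain V q).
Proof. by split=> [x i a u v|//]; rewrite scaler0 addr0. Qed.

End G0.
Arguments minor : clear implicits.

(** * Integers as scalars *)

Section Scalars.
Variable k : fieldType.

Definition zscal (z : Z) : k := (int_of_Z z)%:~R.

Lemma zscalD a b : zscal (BinInt.Z.add a b) = zscal a + zscal b.
Proof. by rewrite /zscal (rmorphD int_of_Z a b) rmorphD. Qed.
Lemma zscalM a b : zscal (BinInt.Z.mul a b) = zscal a * zscal b.
Proof. by rewrite /zscal (rmorphM int_of_Z a b) rmorphM. Qed.
Lemma zscalN a : zscal (BinInt.Z.opp a) = - zscal a.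
Proof. by rewrite /zscal (rmorphN int_of_Z a) rmorphN. Qed.
Lemma zscal1 : zscal (Zpos xH) = 1.
Proof. by rewrite /zscal (rmorph1 int_of_Z). Qed.
Lemma zscal_sign e : zscal (signZ e) = (-1) ^+ e.
Proof.
by case: e; rewrite ?zscal1 // -[signZ true]/(BinInt.Z.opp (Zpos xH)) zscalN zscal1.
Qed.

(** Characteristic zero enters the elimination here: nonzero integer multipliers and pivots stay
    nonzero in the field. *)
Lemma zscal_eq0 (char0 : [pchar k] =i pred0) z : zscal z = 0 -> z = BinNums.Z0.
Proof.
rewrite /zscal => e; have := int_of_ZK z; suff -> : int_of_Z z = 0 by [].
move: e; case: (int_of_Z z) => n.
  by rewrite -pmulrn => /eqP; rewrite ((pcharf0P k).1 char0) => /eqP->.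
by rewrite NegzE mulrNz -pmulrn => /eqP; rewrite oppr_eq0 ((pcharf0P k).1 char0).
Qed.

End Scalars.

(** * The differential in coordinates *)

Lemma size_del n (T : seq gen) (p : pred nat) : size T = n ->
  size (del T p) = #|[pred l : 'I_n | p l]|.
Proof.
move=> sz; rewrite size_map sz -val_enum_ord filter_map size_map.
exact: size_filter_enum.
Qed.

Lemma diff_coefs_valid q t s : valid q.+1 t -> s \in diff_coefs t -> valid q s.1.
Proof.
case: t => T c /andP[/= /eqP sz ss].
have sd p : sorted gen_lt (del T p).
  rewrite /del; apply: (subseq_sorted gen_lt_trans) ss.
  rewrite -[X in subseq _ X](mkseq_nth X T).
  exact/map_subseq/filter_subseq.
rewrite /diff_coefs mem_cat /= sz => /orP[] /flatten_mapP [i].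
  rewrite mem_iota add0n => /= lti /flatten_mapP [b _].
  case: (gen_bracket _ _) => [[e d]|] //; case: ifP => // _; rewrite inE => /eqP->.
  rewrite /valid /= sd andbT (size_del _ sz).
  by rewrite (eq_card (B := predC1 (Ordinal lti))) ?cardC1 ?card_ord /=.
rewrite mem_iota add0n => /= lti /flatten_mapP [j].
rewrite mem_filter mem_iota => /and3P[ij _ ltj].
rewrite /diff_coefs_br; case: (gen_bracket _ _) => [[e d]|] //.
case E: (insert_gen _ _) => [[e' u]|] //; rewrite inE => /eqP->.
have [us su] := insert_gen_sorted (sd _) E.
rewrite /valid /= us andbT su (size_del _ sz).
apply/eqP/(@card_pred2C q (Ordinal lti) (Ordinal ltj)).
by rewrite -val_eqE /= ltn_eqF.
Qed.

Section Differential.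
Variable k : fieldType.
Notation V := (g0 k).
Notation bs := (map (bas k)).

Lemma bracketDl a (u v w : V) : bracket (a *: u + v) w = a *: bracket u w + bracket v w.
Proof.
apply/ffunP=> c; rewrite !ffunE !bracketE /GRing.scale /=.
by case: c => /=; rewrite ?ffunE /GRing.scale /=; ring.
Qed.

Lemma bracketDr a (u v w : V) : bracket w (a *: u + v) = a *: bracket w u + bracket w v.
Proof.
apply/ffunP=> c; rewrite !ffunE !bracketE /GRing.scale /=.
by case: c => /=; rewrite ?ffunE /GRing.scale /=; ring.
Qed.

Lemma bracket_bas a b : bracket (bas k a) (bas k b) =
  if gen_bracket a b is Some (e, d) then (-1) ^+ e *: bas k d else 0.
Proof.
rewrite /bracket (bigD1 a) //= (bigD1 b) //= !ffunE !eqxx mulr1 scale1r.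
rewrite !big1 ?addr0 => [|c ca|c cb].
- by case: a; case: b; rewrite /= ?expr0 ?expr1 ?scale1r ?scaleN1r ?oppr0 ?opprK.
- rewrite big1 // => d _; rewrite ffunE (negPf ca) mul0r scale0r //.
- by rewrite [bas k b c]ffunE (negPf cb) mulr0 scale0r.
Qed.

Lemma bracket_basl a (v : V) c : (bracket (bas k a) v c : k) =
  \sum_(b <- gens) (v b : k) *
     (if gen_bracket a b is Some (e, d) then (-1) ^+ e * (c == d)%:R else 0).
Proof.
have bD d u w :
    bracket (bas k d) (u + w) = bracket (bas k d) u + bracket (bas k d) w.
  by have := bracketDr 1 u w (bas k d); rewrite !scale1r.
have b0 d : bracket (bas k d) 0 = 0.
  by have := bracketDr (-1) 0 0 (bas k d); rewrite scaler0 addr0 scaleN1r addNr.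
rewrite {1}(bas_expand v) (big_morph _ (bD a) (b0 a)) sum_ffunE.
apply: eq_bigr => b _; have := bracketDr (v b) (bas k b) 0 (bas k a).
rewrite !addr0 b0 addr0 => ->; rewrite ffunE bracket_bas.
by case: (gen_bracket a b) => [[e d]|]; rewrite !ffunE.
Qed.

Lemma map_args n (T : seq gen) (p : pred nat) : size T = n ->
  [seq args n (bs T) l | l <- enum 'I_n & p (val l)] = bs (del T p).
Proof.
move=> sz; rewrite /del -map_comp sz.
have -> : [seq l <- iota 0 n | p l] = map val [seq l <- enum 'I_n | p (val l)].
  by rewrite -filter_map val_enum_ord.
rewrite -map_comp; apply: eq_map => l; rewrite /= ffunE (nth_map X) // sz.
exact: ltn_ord.
Qed.

Lemma argsE n (T : seq gen) (l : 'I_n) : size T = n ->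
  args n (bs T) l = bas k (nth X T l).
Proof. by move=> sz; rewrite ffunE (nth_map X) // sz ltn_ord. Qed.

Lemma sum_iota n (P : pred nat) (F : nat -> k) :
  \sum_(i <- iota 0 n | P i) F i = \sum_(i < n | P i) F i.
Proof. by rewrite -(big_mkord P F) /index_iota subn0. Qed.

(** In the first sum the value of f is expanded in the basis and acted upon; in the second the
    bracket, standing in front, is moved to its sorted place, which gives the extra sign. *)
Lemma coef_diff q (f : cochain V q) (fC : CE_cochain f) t : size t.1 = q.+1 ->
  coef (CE_diff (@bracket k) f) t =
  \sum_(s <- diff_coefs t) zscal k s.2 * coef f s.1.
Proof.
case: t => T c; rewrite [(T, c).1]/= => sz.
have -> : diff_coefs (T, c) = flatten [seq diff_coefs_act T c i | i <- iota 0 q.+1] ++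
    flatten [seq flatten [seq diff_coefs_br T c i j | j <- iota 0 q.+1 & (i < j)%N]
      | i <- iota 0 q.+1] by rewrite /diff_coefs sz.
rewrite {1}/coef [(T, c).1]/= [(T, c).2]/= /CE_diff ffunE !sum_ffunE big_cat.
congr (_ + _); rewrite big_flatten big_map sum_iota; apply: eq_bigr => i _.
  rewrite ffunE (argsE _ sz) (map_args (predC1 (i : nat)) sz) bracket_basl.
  rewrite /diff_coefs_act big_flatten big_map [LHS]mulr_sumr.
  apply: eq_bigr => b _; case: (gen_bracket _ _) => [[e d]|]; last by rewrite big_nil !mulr0.
  rewrite gen_eqbE eq_sym; case: eqP => _; last by rewrite big_nil !mulr0.
  by rewrite big_seq1 [_.1]/= [_.2]/= zscal_sign signr_addb signr_odd mulr1 mulrCA mulrC.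
rewrite sum_ffunE big_flatten big_map big_filter sum_iota.
apply: eq_bigr => j ij.
rewrite ffunE !(argsE _ sz) (map_args (fun l => (l != i) && (l != j)) sz) bracket_bas.
rewrite /diff_coefs_br.
have szd : (size (del T (fun l => (l != i) && (l != j :> nat)))).+1 = q.
  rewrite (size_del _ sz); apply: (@card_pred2C q i j).
  by rewrite -val_eqE /= ltn_eqF.
have szm : (size ([::] : seq V) +
    size (bs (del T (fun l => (l != i) && (l != j :> nat))))).+1 = q.
  by rewrite (size_map (bas k)).
case: (gen_bracket _ _) => [[e d]|]; last first.
  by rewrite big_nil (multilinear_args0 fC.1 (s1 := [::]) szm) ffunE scaler0.
rewrite (multilinear_argsZ fC.1 (s1 := [::]) _ _ szm).
rewrite (insert_gen_correct fC d (p := [::])) //.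
case: (insert_gen _ _) => [[e' u]|]; last by rewrite !scaler0 ffunE big_nil scaler0.
rewrite big_seq1 !ffunE [_.1]/= [_.2]/= zscal_sign !signr_addb signr_odd.
by rewrite -!mulrA.
Qed.

End Differential.

(** * Correctness of the elimination *)

HB.instance Definition _ := hasDecEq.Build positive BinPos.Pos.eqb_spec.

Section Elimination.
Variables (k : fieldType) (n : nat) (key_vec : positive -> 'rV[k]_n).
Hypothesis char0 : [pchar k] =i pred0.
Local Notation zscal := (zscal k).

Definition row_val (r : srow) : 'rV[k]_n := \sum_(t <- r) zscal t.2 *: key_vec t.1.

Lemma row_val_cons t r : row_val (t :: r) = zscal t.2 *: key_vec t.1 + row_val r.
Proof. exact: big_cons. Qed.

Lemma row_val_scale a (r : srow) :
  row_val [seq (t.1, BinInt.Z.mul a t.2) | t <- r] = zscal a *: row_val r.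
Proof.
rewrite /row_val big_map scaler_sumr; apply: eq_bigr => t _.
by rewrite zscalM scalerA.
Qed.

(** True for rows in any order: an unsorted row can only make the merge miss a cancellation. *)
Lemma row_val_lincomb a p b r :
  row_val (lincomb a p b r) = zscal a *: row_val p + zscal b *: row_val r.
Proof.
have nilE : row_val [::] = 0 by exact: big_nil.
elim: p r => [|[i x] p IHp] r; first by rewrite [LHS]row_val_scale nilE scaler0 add0r.
elim: r => [|[j y] r IHr]; first by rewrite [LHS]row_val_scale nilE scaler0 addr0.
rewrite /=; case E: (BinPos.Pos.compare i j).
- have {E}-> := BinPos.Pos.compare_eq _ _ E.
  have S : zscal a *: row_val ((j, x) :: p) + zscal b *: row_val ((j, y) :: r) =
     zscal (BinInt.Z.add (BinInt.Z.mul a x) (BinInt.Z.mul b y)) *: key_vec j +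
       (zscal a *: row_val p + zscal b *: row_val r).
    by rewrite !row_val_cons !scalerDr zscalD !zscalM scalerDl !scalerA addrACA.
  rewrite S; case: (BinInt.Z.add _ _) => [|z|z]; rewrite ?row_val_cons IHp //.
  by rewrite scale0r add0r.
- by rewrite !row_val_cons IHp !row_val_cons /= zscalM !scalerDr !scalerA addrA.
- by rewrite row_val_cons IHr !row_val_cons /= zscalM !scalerDr !scalerA addrCA.
Qed.

Lemma row_val_normalize (s : seq (key * Z)) :
  row_val (normalize s) = \sum_(t <- s) zscal t.2 *: key_vec (key_code t.1).
Proof.
elim: s => [|t s IHs]; first by rewrite big_nil; exact: big_nil.
by rewrite [LHS]row_val_lincomb IHs big_cons zscal1 !scale1r /row_val big_seq1.
Qed.

(** A nonzero [a] makes the step reversible. The test on [a'] inside [eliminate] provides it with no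
    invariant on the stored pivots. *)
Lemma row_val_eliminate p r : exists a b, a != 0 /\
  row_val (eliminate p r) = a *: row_val r + b *: row_val p.
Proof.
have triv : exists a b, a != 0 /\ row_val r = a *: row_val r + b *: row_val p.
  by exists 1, 0; rewrite oner_eq0 scale1r scale0r addr0.
case: p r triv => [|[i a] p] [|[j b] r] triv //=.
case: (BinInt.Z.ggcd a b) => _ [a' b'].
case: BinInt.Z.eqb_spec => [//|a'0].
exists (zscal a'), (zscal (BinInt.Z.opp b')); rewrite -row_val_lincomb; split=> //.
by apply/eqP=> /(zscal_eq0 char0).
Qed.

Definition row_span (rs : seq srow) : 'M[k]_n := (\sum_(r <- rs) <<row_val r>>)%MS.

Lemma sub_row_span r rs : r \in rs -> (row_val r <= row_span rs)%MS.
Proof.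
elim: rs => // s rs IHrs; rewrite inE /row_span big_cons => /orP[/eqP->|/IHrs h].
  by apply: submx_trans (addsmxSl _ _); rewrite genmxE.
exact: submx_trans h (addsmxSr _ _).
Qed.

Lemma row_span_sub rs m (A : 'M_(m, n)) :
  (forall r, r \in rs -> (row_val r <= A)%MS) -> (row_span rs <= A)%MS.
Proof.
elim: rs => [|s rs IHrs] h; first by rewrite /row_span big_nil sub0mx.
rewrite /row_span big_cons addsmx_sub genmxE h ?mem_head // IHrs // => r rr.
by rewrite h // inE rr orbT.
Qed.

(** Modulo the stored rows, [r] and its reduction span the same space, since every step can be
    undone; the amount of fuel is irrelevant. *)
Lemma row_val_reduce m (P : 'M_n) fuel r :
  (forall i p, M.find i m = Some p -> (row_val p <= P)%MS) ->
  (row_val r <= P + row_val (reduce fuel m r))%MS /\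
  (row_val (reduce fuel m r) <= P + row_val r)%MS.
Proof.
move=> mP; elim: fuel r => [|fuel IHf] r; first by rewrite !addsmxSr.
case: r => [|[i z] r]; first by rewrite !addsmxSr.
rewrite [reduce _ _ _]/=; set r0 := _ :: r.
case E: (M.find i m) => [p|]; last by rewrite !addsmxSr.
have pP := mP _ _ E; have [h1 h2] := IHf (eliminate p r0).
have [a [b [a0 e]]] := row_val_eliminate p r0; split.
  have -> : row_val r0 = a^-1 *: row_val (eliminate p r0) + (- (a^-1 * b)) *: row_val p.
    by rewrite e scalerDr !scalerA mulVf // scale1r scaleNr addrK.
  rewrite addmx_sub ?scalemx_sub //.
  exact: submx_trans pP (addsmxSl _ _).
apply: submx_trans h2 _; rewrite addsmx_sub addsmxSl e addmx_sub ?scalemx_sub //.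
  exact: addsmxSr.
exact: submx_trans pP (addsmxSl _ _).
Qed.

(** The one invariant of the table. Preservation of the span requires no relation between the index
    of an entry and its leading key. *)
Definition stored (st : M.t srow * seq srow) :=
  forall i p, M.find i st.1 = Some p -> p \in st.2.

Lemma insert_row_spec st r : stored st ->
  stored (insert_row st r) /\ (row_span (insert_row st r).2 :=: row_span st.2 + row_val r)%MS.
Proof.
case: st => m P iP; rewrite /insert_row.
have mP i p : M.find i m = Some p -> (row_val p <= row_span P)%MS.
  by move/iP; exact: sub_row_span.
have [] := row_val_reduce 1000 r mP; move: (reduce _ _ _) => [|[i z] r'] h1 h2.
  split=> //; apply/eqmxP; rewrite addsmxSl addsmx_sub submx_refl.
  apply: submx_trans h1 _; rewrite addsmx_sub submx_refl.
  by rewrite /row_val big_nil sub0mx.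
split.
  move=> j p /=; have [->|ij] := eqVneq j i.
    by rewrite M.gss => -[<-]; rewrite mem_head.
  by rewrite M.gso => [/iP h|]; [rewrite inE h orbT | exact/eqP].
apply/eqmxP; rewrite /row_span big_cons -/(row_span P) !addsmx_sub !genmxE h2.
rewrite addsmxSl addsmxSr /=; apply: submx_trans h1 _.
by rewrite addsmx_sub addsmxSr; apply: submx_trans (addsmxSl _ _); rewrite genmxE.
Qed.

Lemma row_span_echelon rs : (row_span (echelon rs) :=: row_span rs)%MS.
Proof.
rewrite /echelon; have i0 : stored (M.empty srow, [::]).
  by move=> i p /=; rewrite M.gempty.
have : (row_span (foldl insert_row (M.empty srow, [::]) rs).2 :=:
    row_span (M.empty srow, [::]).2 + row_span rs)%MS.
  elim: rs (_, _) i0 => [|r rs IHrs] st ist /=.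
    by rewrite {3}/row_span big_nil; apply/eqmx_sym/addsmx0.
  have [ist' e] := insert_row_spec r ist.
  apply: eqmx_trans (IHrs _ ist') _; rewrite {4}/row_span big_cons -/(row_span rs) addsmxA.
  apply: adds_eqmx (eqmx_refl _); apply: eqmx_trans e _.
  exact: adds_eqmx (eqmx_refl _) (eqmx_sym (genmxE _)).
move/eqmx_trans; apply; rewrite {1}/row_span big_nil; exact: adds0mx.
Qed.

Lemma row_span_perm rs rs' : perm_eq rs rs' -> row_span rs = row_span rs'.
Proof. exact: perm_big. Qed.

Section Support.
Variable Q : pred positive.
Hypothesis evQ : forall p, Q p ->
  exists i, forall p', key_vec p' 0 i = (p' == p)%:R.

(** [Q] selects the keys that some coordinate separates from all others. Off [Q] a vector may be
    zero, and a nonzero pivot would prove nothing. *)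
Definition supp (r : srow) : bool := all (fun t => Q t.1) r.

Lemma supp_lincomb a p b r : supp p -> supp r -> supp (lincomb a p b r).
Proof.
have sc c s : supp s -> supp [seq (t.1, BinInt.Z.mul c t.2) | t <- s].
  by rewrite /supp all_map.
elim: p r => [|[i x] p IHp] r sp sr; first exact: sc.
elim: r sr => [|[j y] r IHr] sr; first exact: sc.
case/andP: (sp) => Qi sp'; case/andP: (sr) => Qj sr' /=.
case: (BinPos.Pos.compare i j).
- by case: (BinInt.Z.add _ _) => [|z|z]; rewrite /= ?Qi; apply: IHp.
- by rewrite /= Qi; apply: IHp.
- by rewrite /= Qj; apply: IHr.
Qed.

Lemma supp_normalize (s : seq (key * Z)) :
  all (fun t => Q (key_code t.1)) s -> supp (normalize s).
Proof.
elim: s => [//|t s IHs] /andP[Qt /IHs h].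
rewrite -[normalize _]/(lincomb _ [:: (key_code t.1, t.2)] _ (normalize s)).
by apply: supp_lincomb h; rewrite /supp /= Qt.
Qed.

Local Arguments lincomb : simpl never.

Lemma supp_eliminate p r : supp p -> supp r -> supp (eliminate p r).
Proof.
case: p r => [|[i a] p] [|[j b] r] sp sr //=.
case: (BinInt.Z.ggcd a b) => _ [a' b']; case: ifP => // _.
exact: supp_lincomb.
Qed.

Lemma supp_reduce m fuel r :
  (forall i p, M.find i m = Some p -> supp p) -> supp r -> supp (reduce fuel m r).
Proof.
move=> sm; elim: fuel r => // fuel IHf [|[i z] r] // sr /=.
by case E: (M.find i m) => [p|] //; apply/IHf/supp_eliminate => //; apply: sm E.
Qed.

Lemma supp_echelon rs : all supp rs -> all supp (echelon rs).
Proof.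
rewrite /echelon; have i0 : stored (M.empty srow, [::]).
  by move=> i p /=; rewrite M.gempty.
have : all supp (M.empty srow, [::] : seq srow).2 by [].
elim: rs (_, _) i0 => [|r rs IHrs] st ist //= sst /andP[sr srs].
apply: IHrs srs; first exact: (insert_row_spec r ist).1.
rewrite /insert_row.
have : supp (reduce 1000 st.1 r).
  by apply: supp_reduce sr => i p /ist h; apply: (allP sst).
by case: (reduce _ _ _) => [|[i z] r'] //= ->.
Qed.

Lemma ltb_trans : transitive BinPos.Pos.ltb.
Proof.
move=> y x z /BinPos.Pos.ltb_lt xy /BinPos.Pos.ltb_lt yz.
by apply/BinPos.Pos.ltb_lt; apply: BinPos.Pos.lt_trans xy yz.
Qed.

Lemma ltb_neq x y : BinPos.Pos.ltb x y -> (y == x) = false.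
Proof.
move/BinPos.Pos.ltb_lt=> lt; apply/eqP=> e; rewrite e in lt.
exact: BinPos.Pos.lt_irrefl lt.
Qed.

(** The coordinate of the leading key of the first row is nonzero there and vanishes on all later
    rows, whose keys are larger; so each row raises the rank by one. *)
Lemma rank_echelon P : all supp P -> sorted leadlt P -> all pivot_ok P ->
  \rank (row_span P) = size P.
Proof.
elim: P => [|r P IHP] /=; first by rewrite /row_span big_nil mxrank0.
move=> /andP[sr sP] pP /andP[pr okP].
have ltP : all (leadlt r) P by apply: order_path_min pP => x y z; apply: ltb_trans.
have rP := IHP sP (path_sorted pP) okP.
case: r sr pP pr ltP => [|[i z] r] // /andP[/= Qi sr] _ /andP[z0 sz] ltP.
have [j evj] := evQ Qi.
have intz r' : all (fun t => BinPos.Pos.ltb i t.1) r' -> row_val r' 0 j = 0.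
  move=> h; rewrite summxE big_seq big1 // => t /(allP h) /ltb_neq e.
  by rewrite mxE evj e mulr0.
have kt : transitive keylt by move=> x y w; apply: ltb_trans.
have rj : row_val ((i, z) :: r) 0 j = zscal z.
  rewrite row_val_cons !mxE evj eqxx mulr1 intz ?addr0 //.
  exact: (order_path_min kt sz).
(* The vanishing of coordinate [j] is phrased as a kernel to pass from the rows to their span. *)
have Pj (v : 'rV_n) : (v <= row_span P)%MS -> v 0 j = 0.
  have h : (row_span P <= kermx (delta_mx j (0 : 'I_1)))%MS.
    apply: row_span_sub => r' r'P; apply/sub_kermxP; rewrite -colE.
    apply/matrixP=> a b; rewrite !mxE (ord1 a) intz //.
    have := allP ltP _ r'P; have := allP okP _ r'P.
    case: r' {r'P} => [|[i' z'] r'] // /andP[_ s'] lt.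
    rewrite /= (lt : BinPos.Pos.ltb i i') /=.
    apply/allP=> t tr; apply: ltb_trans lt _.
    exact: (allP (order_path_min kt s') _ tr).
  move/submx_trans/(_ h)/sub_kermxP; rewrite -colE => /matrixP/(_ 0 0).
  by rewrite !mxE.
have nle : ~~ (row_val ((i, z) :: r) <= row_span P)%MS.
  apply/negP => /Pj; rewrite rj => /(zscal_eq0 char0) e.
  by rewrite e in z0.
rewrite -[RHS]/(size P).+1 -rP /row_span big_cons -/(row_span P).
apply/eqP; rewrite eqn_leq; apply/andP; split.
  apply: leq_trans (mxrank_adds_leqif _ _) _; rewrite -[X in (_ <= X)%N]add1n leq_add2r genmxE.
  exact: rank_leq_row.
apply: rank_ltmx; rewrite /ltmx addsmxSr addsmx_sub genmxE submx_refl andbT.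
exact: nle.
Qed.

Theorem sparse_rankP rs d : all supp rs -> sparse_rank rs = Some d ->
  \rank (row_span rs) = d.
Proof.
rewrite /sparse_rank; set rs' := sort _ rs; set P := sort _ _.
move=> srs; case: ifP => // /andP[sP okP] [<-].
have perm1 : perm_eq rs rs' by rewrite perm_sym perm_sort.
have perm2 : perm_eq (echelon rs') P by rewrite perm_sym perm_sort.
rewrite (row_span_perm perm1) -(row_span_echelon rs') (row_span_perm perm2) rank_echelon //.
by rewrite all_sort supp_echelon // all_sort.
Qed.

End Support.
End Elimination.

(** * The dimension of the cohomology *)

(** Vectors are rows, on which matrices act from the right. The rows of [E] are a basis of a
    complement of the row space of A in the kernel of B. *)
Lemma mx_cohomology (k : fieldType) m n p (A : 'M[k]_(m, n)) (B : 'M_(n, p)) :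
  A *m B = 0 ->
  exists (E : 'M_((n - \rank B) - \rank A, n)), E *m B = 0 /\
    forall z : 'rV_n, z *m B = 0 -> exists c,
      (z - c *m E <= A)%MS /\ forall c', (z - c' *m E <= A)%MS -> c' = c.
Proof.
move=> AB; have AK : (A <= kermx B)%MS by apply/sub_kermxP.
pose U := (kermx B :\: A)%MS.
have rU : \rank U = ((n - \rank B) - \rank A)%N.
  rewrite -mxrank_ker -(mxrank_cap_compl (kermx B) A) -/U.
  by rewrite (capmx_idPr AK) addKn.
rewrite -rU; exists (row_base U); split.
  by apply/sub_kermxP; rewrite eq_row_base diffmxSl.
move=> z /sub_kermxP zK.
have : (z <= U + (kermx B :&: A))%MS by rewrite addsmx_diff_cap_eq.
case/sub_addsmxP => [[u v] /= zE].
have : (u *m U <= row_base U)%MS by rewrite eq_row_base submxMl.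
case/submxP => c uc; exists c.
have zc : (z - c *m row_base U <= A)%MS.
  rewrite zE uc addrC addKr.
  exact: submx_trans (submxMl _ _) (capmxSr _ _).
(* The difference of the two combinations lies both in the complement and in the row space of A,
   hence is zero. *)
split=> // c' zc'; apply/(row_free_inj (row_base_free U))/eqP; rewrite -subr_eq0.
rewrite -mulmxBl -submx0 -(capmx_diff (kermx B) A) sub_capmx -/U.
rewrite -(eq_row_base U) submxMl /=.
have -> : (c' - c) *m row_base U = (z - c *m row_base U) - (z - c' *m row_base U).
  by rewrite mulmxBl opprB [RHS]addrC addrA subrK.
by rewrite addmx_sub // eqmx_opp.
Qed.

Lemma push_gen_inj p b p' b' : push_gen p b = push_gen p' b' -> p = p' /\ b = b'.
Proof. by case: b; case: b' => //= -[->]. Qed.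

(** Codes are words of four-bit digits behind a leading 1, so they can be read back from the last
    digit. *)
Lemma key_code_inj : injective key_code.
Proof.
have aux s s' : foldl push_gen xH s = foldl push_gen xH s' -> s = s'.
  elim/last_ind: s s' => [|s b IHs] s'; case/lastP: s' => [|s' b'] //;
    rewrite ?foldl_rcons.
  - by case: b'.
  - by case: b.
  - by case/push_gen_inj => /IHs-> ->.
by move=> [s b] [s' b'] /(aux (b :: s) (b' :: s')) [-> ->].
Qed.

Lemma mem_combs q l s : (s \in combs q l) = subseq s l && (size s == q).
Proof.
elim: l q s => [|a l IHl] [|q] s; first by rewrite inE; case: s.
- by case: s.
- by rewrite inE; case: s => // b s; rewrite andbF.
case: s => [|b s].
  by rewrite mem_cat IHl andbF orbF; apply/mapP => -[].
rewrite mem_cat IHl /= eqSS; apply/orP/idP.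
  case=> [/mapP[s' s'l [-> ->]]|].
    by move: s'l; rewrite IHl eqxx.
  case/andP=> h ->; rewrite andbT; case: eqP => // _.
  by move: h; apply: subseq_trans (subseq_cons _ _).
case: eqP => [->|_] /andP[h sz]; [left|by right; rewrite h].
by apply: map_f; rewrite IHl h.
Qed.

Lemma uniq_combs q l : uniq l -> uniq (combs q l).
Proof.
elim: l q => [|a l IHl] [|q] //= /andP[al ul].
rewrite cat_uniq map_inj_uniq ?IHl //=; last by move=> s s' [].
rewrite andbT; apply/hasPn => s; rewrite mem_combs => /andP[sl _].
by apply/mapP=> -[s' _ e]; move: al; rewrite (mem_subseq sl) // e mem_head.
Qed.

Lemma mem_allkeys q t : (t \in allkeys q) = valid q t.
Proof.
case: t => s b; rewrite /valid /=; apply/allpairsP/andP => [[[s' b'] []]|[sz ss]].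
  rewrite mem_combs => /andP[h sz] _ [-> _]; split=> //.
  exact: (subseq_sorted gen_lt_trans) h sorted_gens.
exists (s, b); split; rewrite ?mem_gens // mem_combs sz andbT.
(* An increasing tuple is [gens] filtered by its own members, hence a subsequence. *)
have -> : s = [seq x <- gens | x \in s].
  apply: sorted_gen_lt_eq => //; first exact: (sorted_filter gen_lt_trans _ sorted_gens).
  by move=> x; rewrite mem_filter mem_gens andbT.
exact: filter_subseq.
Qed.

Lemma uniq_allkeys q : uniq (allkeys q).
Proof. by apply: allpairs_uniq; [exact: uniq_combs| |move=> [? ?] [? ?]]. Qed.

Lemma sum_nth_eq (R : pzSemiRingType) (T : eqType) (x0 : T) (K : seq T) (F : T -> R) t :
  uniq K -> t \in K ->
  \sum_(i < size K) F (nth x0 K i) * (t == nth x0 K i)%:R = F t.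
Proof.
move=> uK tK; have lt : (index t K < size K)%N by rewrite index_mem.
rewrite (bigD1 (Ordinal lt)) //= nth_index // eqxx mulr1 big1 ?addr0 // => i ne.
case: eqP => [e|]; last by rewrite mulr0.
case/eqP: ne; apply: val_inj; rewrite /= e index_uniq //.
Qed.

(** * The subcomplex selected by a predicate on keys *)

Section Cohomology.
Variables (k : fieldType) (P : pred key).
Hypothesis char0 : [pchar k] =i pred0.
Notation V := (g0 k).
Notation bs := (map (bas k)).
Notation zscal := (zscal k).
Notation W q := ({ffun 'I_q -> V} -> V).
Notation d := (CE_diff (@bracket k)).

Definition keys q := [seq t <- allkeys q | P t].
Definition nkeys q := size (keys q).
(** Taking [has_weight w] for [P] gives the cochains of weight w, and [xpredT] gives all
    cochains. *)
Definition supported q (f : cochain V q) : Prop :=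
  CE_cochain f /\ forall t, valid q t -> ~~ P t -> coef f t = 0.

Lemma mem_keys q t : (t \in keys q) = P t && valid q t.
Proof. by rewrite mem_filter mem_allkeys. Qed.

Lemma uniq_keys q : uniq (keys q). Proof. exact/filter_uniq/uniq_allkeys. Qed.

Definition nthkey q (i : 'I_(nkeys q)) : key := nth ([::], X) (keys q) i.

Lemma nthkeyP q (i : 'I_(nkeys q)) : nthkey i \in keys q.
Proof. exact: mem_nth. Qed.

Lemma valid_nthkey q (i : 'I_(nkeys q)) : valid q (nthkey i).
Proof. by have := nthkeyP i; rewrite mem_keys => /andP[]. Qed.

Lemma nthkey_eq q (i j : 'I_(nkeys q)) : (nthkey i == nthkey j) = (i == j).
Proof. by rewrite nth_uniq ?uniq_keys. Qed.

Definition coords q (f : W q) : 'rV[k]_(nkeys q) := \row_i coef (q := q) f (nthkey i).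

Lemma coordsD q (f g : W q) a : coords (a *: f + g) = a *: coords f + coords g.
Proof. by apply/rowP=> i; rewrite !mxE /coef !ffunE. Qed.

Lemma coords0 q : coords (0 : W q) = 0.
Proof. by apply/rowP=> i; rewrite !mxE /coef ffunE. Qed.

Lemma coordsB q (f g : W q) : coords (f - g) = coords f - coords g.
Proof. by rewrite addrC -scaleN1r coordsD scaleN1r addrC. Qed.

Lemma coords_sum q (I : Type) (r : seq I) (c : I -> k) (F : I -> W q) :
  coords (\sum_(i <- r) c i *: F i) = \sum_(i <- r) c i *: coords (F i).
Proof.
elim: r => [|i r IHr]; first by rewrite !big_nil coords0.
by rewrite !big_cons coordsD IHr.
Qed.

Lemma supportedD q (f g : W q) a :
  supported (q := q) f -> supported (q := q) g -> supported (q := q) (a *: f + g).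
Proof.
move=> [fC f0] [gC g0]; split; first exact: CE_cochain_lin.
move=> t vt Pt; have := f0 t vt Pt; have := g0 t vt Pt.
by rewrite /coef !ffunE => -> ->; rewrite scaler0 addr0.
Qed.

Lemma supported0 q : supported (q := q) (0 : W q).
Proof. by split; [exact: CE_cochain0|move=> t _ _; rewrite /coef ffunE]. Qed.

Lemma supported_sum q (I : Type) (r : seq I) (c : I -> k) (F : I -> W q) :
  (forall i, supported (q := q) (F i)) ->
  supported (q := q) (\sum_(i <- r) c i *: F i).
Proof.
move=> FS; elim: r => [|i r IHr]; first by rewrite big_nil; exact: supported0.
by rewrite big_cons; apply: supportedD.
Qed.

Lemma coords_inj q (f g : W q) : supported (q := q) f -> supported (q := q) g ->
  coords f = coords g -> f = g.
Proof.
move=> fS gS e; apply/eqP; rewrite -subr_eq0; apply/eqP.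
have [hC h0] : supported (q := q) (f - g).
  by rewrite addrC -scaleN1r; apply: supportedD.
apply: (cochain_coef0 hC) => t vt; case Pt: (P t); last by rewrite h0 ?Pt.
have tK : t \in keys q by rewrite mem_keys Pt.
have lt : (index t (keys q) < nkeys q)%N by rewrite index_mem.
have /rowP/(_ (Ordinal lt)) : coords (f - g) = 0 by rewrite coordsB e subrr.
by rewrite !mxE /nthkey nth_index.
Qed.

Definition cochain_of q (v : 'rV[k]_(nkeys q)) : W q :=
  \sum_i v 0 i *: (minor k q (nthkey i) : W q).

Lemma supported_minor q t : valid q t -> P t -> supported (minor k q t).
Proof.
move=> vt Pt; split; first exact: minor_cochain.
move=> t' vt' Pt'; rewrite coef_minor //; case: eqP => // e.
by rewrite -e Pt in Pt'.
Qed.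

Lemma supported_cochain_of q v : supported (q := q) (@cochain_of q v).
Proof.
apply: supported_sum => i; apply: supported_minor; first exact: valid_nthkey.
by have := nthkeyP i; rewrite mem_keys => /andP[].
Qed.

Lemma coords_cochain_of q v : coords (@cochain_of q v) = v.
Proof.
rewrite coords_sum; apply/rowP=> i; rewrite summxE (bigD1 i) //= big1 => [|j ji].
  by rewrite !mxE coef_minor ?valid_nthkey // eqxx mulr1 addr0.
by rewrite !mxE coef_minor ?valid_nthkey // nthkey_eq (negPf ji) mulr0.
Qed.

Definition diff_mx q : 'M[k]_(nkeys q, nkeys q.+1) :=
  \matrix_(i, j) \sum_(s <- diff_coefs (nthkey j)) zscal s.2 * (s.1 == nthkey i)%:R.

(** An equality, not an implication: that d f vanishes off [P] needs the source keys to be off [P]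
    as well. *)
Definition diff_coefs_closed q :=
  all (fun t => all (fun s => P s.1 == P t) (diff_coefs t)) (allkeys q.+1).

Lemma diff_coefs_closed_keys q t s : diff_coefs_closed q ->
  t \in keys q.+1 -> s \in diff_coefs t -> s.1 \in keys q.
Proof.
move=> cl; rewrite !mem_keys => /andP[Pt vt] st.
rewrite (diff_coefs_valid vt st) andbT.
have /allP/(_ _ st)/eqP-> // := allP cl _ (etrans (mem_allkeys _ _) vt).
Qed.

Lemma two_neq0 : 2%:R != 0 :> k.
Proof. by rewrite ((pcharf0P k).1 char0). Qed.

Lemma d_cochain q (f : cochain V q) : CE_cochain f -> CE_cochain (d f).
Proof.
move=> fC; split; first exact: (CE_diff_multilinear (@bracketDl k) (@bracketDr k) fC.1).
exact: (CE_diff_alternating (@bracketDl k) (@bracketDr k) (@bracketvv k) two_neq0).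
Qed.

Lemma supported_d q (f : cochain V q) : diff_coefs_closed q -> supported f -> supported (d f).
Proof.
move=> cl [fC f0]; split; first exact: d_cochain.
move=> t vt Pt; rewrite coef_diff //; last by case/andP: vt => /eqP.
rewrite big_seq big1 // => s st; rewrite f0 ?mulr0 //; first exact: (diff_coefs_valid vt st).
have /allP/(_ _ st)/eqP-> // := allP cl _ (etrans (mem_allkeys _ _) vt).
Qed.

Lemma coords_d q (f : W q) : diff_coefs_closed q -> supported (q := q) f ->
  coords (d f : W q.+1) = coords f *m diff_mx q.
Proof.
move=> cl [fC f0]; apply/rowP=> j; rewrite !mxE coef_diff //; last first.
  by case/andP: (valid_nthkey j) => /eqP.
under [RHS]eq_bigr => i _ do rewrite !mxE mulr_sumr.
rewrite exchange_big big_seq [RHS]big_seq; apply: eq_bigr => s sj.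
have sK := diff_coefs_closed_keys cl (nthkeyP j) sj.
rewrite -(sum_nth_eq ([::], X) (fun t => coef (q := q) f t) (uniq_keys q) sK) mulr_sumr.
by apply: eq_bigr => i _; rewrite mulrCA.
Qed.

Definition key_vec q (p : positive) : 'rV[k]_(nkeys q) :=
  \row_i (p == key_code (nthkey i))%:R.

(** A sparse row belongs to a key of degree q+1, hence is a column of [diff_mx]; the rank is
    therefore compared through the transpose. *)
Lemma rank_diff_mx q r : diff_coefs_closed q ->
  diff_rank (keys q.+1) = Some r -> \rank (diff_mx q) = r.
Proof.
move=> cl rk; rewrite -mxrank_tr.
have rowE j : row j (diff_mx q)^T = row_val (key_vec q) (normalize (diff_coefs (nthkey j))).
  rewrite row_val_normalize; apply/rowP=> i; rewrite !mxE summxE.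
  by apply: eq_bigr => s _; rewrite !mxE (inj_eq key_code_inj).
have -> : (\rank (diff_mx q)^T =
    \rank (row_span (key_vec q) [seq normalize (diff_coefs t) | t <- keys q.+1]))%N.
  apply: eqmx_rank; apply/andP; split.
    by apply/row_subP=> j; rewrite rowE; apply/sub_row_span/map_f/nthkeyP.
  apply: row_span_sub => r' /mapP[t tK ->].
  have lt : (index t (keys q.+1) < nkeys q.+1)%N by rewrite index_mem.
  have := rowE (Ordinal lt); rewrite /nthkey nth_index // => <-.
  exact: row_sub.
apply: (sparse_rankP char0 (Q := fun p => p \in map key_code (keys q))) rk.
  move=> p /mapP[t tK ->].
  have lt : (index t (keys q) < nkeys q)%N by rewrite index_mem.
  exists (Ordinal lt) => p'; rewrite mxE /nthkey nth_index //.
rewrite all_map; apply/allP=> t tK; apply: supp_normalize; apply/allP=> s st.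
exact/map_f/(diff_coefs_closed_keys cl tK).
Qed.

Lemma diff_mx_comp q :
  diff_coefs_closed q -> diff_coefs_closed q.+1 -> dd_ok (allkeys q.+2) ->
  diff_mx q *m diff_mx q.+1 = 0.
Proof.
move=> cl cl' ok; apply/matrixP=> i j; rewrite !mxE.
have tK := nthkeyP j; move: (tK); rewrite mem_filter => /andP[_ tA].
have /nilP e := allP ok _ tA.
have := row_val_normalize (key_vec q) (flatten
  [seq [seq (u.1, BinInt.Z.mul s.2 u.2) | u <- diff_coefs s.1]
    | s <- diff_coefs (nthkey j)]).
rewrite e /row_val big_nil big_flatten big_map => /esym/rowP/(_ i).
rewrite summxE mxE => e0; rewrite -[RHS]e0.
under [LHS]eq_bigr => m _ do rewrite !mxE mulr_sumr.
rewrite exchange_big big_seq [RHS]big_seq; apply: eq_bigr => s sj.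
have sK := diff_coefs_closed_keys cl' tK sj.
pose G t := \sum_(u <- diff_coefs t) zscal u.2 * (u.1 == nthkey i)%:R.
transitivity (zscal s.2 * G s.1).
  rewrite -(sum_nth_eq ([::], X) G (uniq_keys _) sK) mulr_sumr.
  by apply: eq_bigr => m _; rewrite mulrCA.
rewrite big_map summxE mulr_sumr; apply: eq_bigr => u _.
by rewrite !mxE /= zscalM mulrA (inj_eq key_code_inj).
Qed.

Theorem dim_supported q :
  diff_coefs_closed q -> diff_coefs_closed q.+1 -> dd_ok (allkeys q.+2) ->
  dim_cohomology (@bracket k) supported q.+1
    ((nkeys q.+1 - \rank (diff_mx q.+1)) - \rank (diff_mx q)).
Proof.
move=> cl cl' ok.
have [E [EB EP]] := mx_cohomology (diff_mx_comp cl cl' ok).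
pose e i : W q.+1 := cochain_of (row i E).
have coords_e c : coords (\sum_i c i *: e i) = (\row_i c i) *m E.
  rewrite coords_sum mulmx_sum_row; apply: eq_bigr => i _.
  by rewrite coords_cochain_of mxE.
have eS i : supported (q := q.+1) (e i) by exact: supported_cochain_of.
exists e; split.
  move=> i; split=> //; apply: (@coords_inj q.+2 (d (e i)) 0).
  - exact: supported_d.
  - exact: supported0.
  rewrite coords0 coords_d // coords_cochain_of.
  by rewrite -row_mul EB row0.
move=> z [zS dz].
have /EP[c [cA cU]] : coords (z : W q.+1) *m diff_mx q.+1 = 0.
  by rewrite -coords_d // dz; exact: coords0.
have diffS c' : supported (q := q.+1) (z - \sum_i c' i *: e i).
  by rewrite addrC -scaleN1r; apply: supportedD => //; apply: supported_sum.
exists [ffun i => c 0 i]; split.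
  have : (coords (z - \sum_i [ffun i => c 0 i] i *: e i : W q.+1) <= diff_mx q)%MS.
    rewrite coordsB coords_e (_ : \row_i _ = c) //.
    by apply/rowP=> i; rewrite mxE ffunE.
  case/submxP => v key_vec; exists (cochain_of v); first exact: supported_cochain_of.
  apply: coords_inj; first exact: diffS.
    by apply: supported_d => //; apply: supported_cochain_of.
  by rewrite key_vec coords_d ?coords_cochain_of //; apply: supported_cochain_of.
move=> c' [h hS eh]; apply/ffunP=> i; rewrite ffunE.
have <- : \row_i c' i = c by apply: cU; rewrite -coords_e -coordsB eh coords_d // submxMl.
by rewrite mxE.
Qed.

End Cohomology.

(** * Weights and the grading *)

Definition has_weight (w : Z) (t : key) : bool := BinInt.Z.eqb (weight t) w.

Lemma int_of_weight t :
  int_of_Z (weight t) = (deg t.2)%:Z - \sum_(b <- t.1) (deg b)%:Z.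
Proof.
case: t => s c; rewrite /weight /=.
have dE b : int_of_Z (degZ b) = (deg b)%:Z by case: b.
elim: s => [|b s IHs] /=; first by rewrite big_nil subr0 dE.
rewrite big_cons opprD addrCA addrC -IHs -dE.
exact: (rmorphB int_of_Z).
Qed.

Lemma has_weightE (w : int) t : has_weight (Z_of_int w) t =
  ((deg t.2)%:Z == \sum_(b <- t.1) (deg b)%:Z + w).
Proof.
rewrite /has_weight -subr_eq0 opprD addrA -int_of_weight subr_eq0.
by apply/BinInt.Z.eqb_spec/eqP => [->|<-]; rewrite ?Z_of_intK ?int_of_ZK.
Qed.

Section Weights.
Variable k : fieldType.
Notation V := (g0 k).
Notation bs := (map (bas k)).

Lemma mem_L j (v : V) : (v \in L k j) <-> forall c, v c != 0 :> k -> (deg c)%:Z = j.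
Proof.
split=> [vL c|h].
  apply: contraNeq => dc; pose s := [seq bas k b | b <- gens & (deg b)%:Z == j].
  rewrite (coord_span (vL : v \in <<in_tuple s>>%VS)) sum_ffunE big1 // => i _.
  rewrite ffunE; set b := nth _ _ _.
  have /mapP[b' ] : b \in [seq bas k b | b <- gens & (deg b)%:Z == j].
    exact: mem_nth.
  rewrite mem_filter => /andP[/eqP db _] ->; rewrite ffunE.
  case: eqP => [e|]; last by rewrite scaler0.
  by rewrite e db eqxx in dc.
rewrite (bas_expand v); apply: memv_suml => b _.
have [->|nz] := eqVneq (v b : k) 0; first by rewrite scale0r mem0v.
apply/memvZ/memv_span/map_f; rewrite mem_filter mem_gens andbT.
exact/eqP/h.
Qed.

Lemma bas_L b : bas k b \in L k (deg b)%:Z.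
Proof.
apply/mem_L => c; rewrite ffunE; case: (c =P b) => [-> //|_]; by rewrite eqxx.
Qed.

(** If the determinant is nonzero, so is the product along some permutation p. Then [x l] has a
    nonzero coordinate at the entry [p l] of [s], which forces its degree, and the degrees add up to
    that of the tuple. *)
Lemma minor_weight q t w : size t.1 = q -> has_weight (Z_of_int w) t ->
  CE_cochain_weight (L k) w (minor k q t).
Proof.
case: t => s c /= sz; rewrite has_weightE /= => /eqP wE.
split; first exact: minor_cochain.
move=> i x xL; rewrite /minor [(s, c).1]/= [(s, c).2]/=.
set D := \det _; have [->|nz] := eqVneq D 0; first by rewrite scale0r mem0v.
apply: memvZ.
suff -> : \sum_l i l + w = (deg c)%:Z by exact: bas_L.
rewrite wE; congr (_ + _).
have [p pP] : exists p : 'S_q, forall l, x l (nth X s (p l)) != 0 :> k.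
  apply: contrapT => np; case/eqP: nz; rewrite /D /determinant big1 // => p _.
  have [l xl] : exists l, x l (nth X s (p l)) = 0 :> k.
    apply: contrapT => nl; apply: np; exists p => l; apply/eqP => e.
    by apply: nl; exists l.
  by rewrite (bigD1 l) //= mxE xl mul0r mulr0.
rewrite (big_nth X) sz big_mkord [RHS](reindex_inj (@perm_inj _ p)).
by apply: eq_bigr => l _; have /mem_L/(_ _ (pP l)) -> := xL l.
Qed.

Lemma weight_sum q (w : int) (I : Type) (r : seq I) (c : I -> k)
    (F : I -> {ffun 'I_q -> V} -> V) :
  (forall i, CE_cochain_weight (L k) w (F i : cochain V q)) ->
  CE_cochain_weight (L k) w (\sum_(i <- r) c i *: F i : cochain V q).
Proof.
move=> FW; elim: r => [|i r [IC IW]].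
  rewrite big_nil; split; first exact: CE_cochain0.
  by move=> i x _; rewrite mem0v.
rewrite big_cons; split; first exact: CE_cochain_lin (FW i).1 IC.
move=> j x xL; apply: memvD; last exact: IW.
by apply: memvZ; apply: (FW i).2.
Qed.

(** One direction evaluates f on basis vectors, which are homogeneous; the other writes f as a
    combination of minors of weight w. *)
Lemma supported_weight q (w : int) (f : cochain V q) :
  CE_cochain_weight (L k) w f <-> supported (has_weight (Z_of_int w)) f.
Proof.
split=> [[fC fW]|fS]; last first.
  have <- : cochain_of (coords (has_weight (Z_of_int w)) f) = f.
    apply: (@coords_inj _ (has_weight (Z_of_int w))) => //.
      exact: supported_cochain_of.
    exact: coords_cochain_of.
  apply: weight_sum => i; have := nthkeyP i; rewrite mem_keys => /andP[Pt].
  by case/andP=> /eqP sz _; apply: minor_weight.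
split=> // t /andP[/eqP sz _]; apply: contraNeq => nz; rewrite has_weightE.
have xL l : args q (bs t.1) l \in L k (deg (nth X t.1 l))%:Z.
  by rewrite (argsE _ _ sz); exact: bas_L.
have /mem_L/(_ _ nz) -> := fW _ _ xL.
by rewrite (big_nth X) sz big_mkord.
Qed.

End Weights.

(** * Numerical results *)

(** The index is shifted: this concerns degree q+1, so that an incoming differential always
    exists. *)
Definition betti (P : pred key) q : option nat :=
  if diff_rank (keys P q.+1) is Some r1 then
    if diff_rank (keys P q.+2) is Some r2 then Some (nkeys P q.+1 - r2 - r1)%N
    else None
  else None.

Definition dimH2 (w : int) : nat :=
  if w == - 2%:Z then 19%N
  else if w == - 1%:Z then 26%N
  else if w == 0%:Z then 11%N
  else if w == 1%:Z then 4%N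
  else 0%N.

Definition dimH3 (w : int) : nat :=
  if w == - 7%:Z then 34%N
  else if w == - 6%:Z then 60%N
  else if w == - 5%:Z then 62%N
  else if w == - 4%:Z then 39%N
  else if w == - 3%:Z then 12%N
  else if w == - 2%:Z then 2%N
  else 0%N.

Lemma dd_check : dd_ok (allkeys 3) && dd_ok (allkeys 4).
Proof. by vm_compute. Qed.

Lemma weight_check :
  [&& weight_ok (allkeys 2), weight_ok (allkeys 3) & weight_ok (allkeys 4)].
Proof. by vm_compute. Qed.

Definition in_range_ok (K : seq key) : bool :=
  all (fun t => has (has_weight^~ t) weights) K.

(** The extremes are 1 - (6+6+5) = -16, in degree 3, and 6 - (1+1) = 4, in degree 2. *)
Lemma range_check : in_range_ok (allkeys 2) && in_range_ok (allkeys 3).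
Proof. by vm_compute. Qed.

Definition betti_is (w : Z) q n :=
  if betti (has_weight w) q is Some m then eqn m n else false.

Lemma betti2 : all (fun w => betti_is w 1 (dimH2 (int_of_Z w))) weights.
Proof. by vm_compute. Qed.

Lemma betti3 : all (fun w => betti_is w 2 (dimH3 (int_of_Z w))) weights.
Proof. by vm_compute. Qed.

(** Elimination on the full matrices, all weights together. *)
Lemma betti_total2 : betti xpredT 1 = Some 60%N.
Proof. by vm_compute. Qed.

Lemma betti_total3 : betti xpredT 2 = Some 209%N.
Proof. by vm_compute. Qed.

(** * From the computed numbers to the cohomology *)

Lemma dim_cohomology_ext (k : fieldType) (V : vectType k) (br : V -> V -> V)
    (C C' : forall q, cochain V q -> Prop) q n :
  (forall q f, C q f <-> C' q f) ->
  dim_cohomology br C q n -> dim_cohomology br C' q n.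
Proof.
move=> CC'; suff -> : C = C' by [].
apply: functional_extensionality_dep => p.
by apply: functional_extensionality_dep => f; apply/propext.
Qed.

Lemma closed_weight w q : weight_ok (allkeys q.+1) -> diff_coefs_closed (has_weight w) q.
Proof.
move=> ok; apply/allP=> t tA; apply/allP=> s st.
have /BinInt.Z.eqb_spec e := allP (allP ok _ tA) _ st.
by rewrite /has_weight e.
Qed.

Lemma betti_isP w q n : betti_is w q n -> betti (has_weight w) q = Some n.
Proof. by rewrite /betti_is; case: (betti _ _) => // m /eqnP->. Qed.

Section Final.
Variable k : fieldType.
Hypothesis char0 : [pchar k] =i pred0.

Lemma bettiP P q n :
  diff_coefs_closed P q -> diff_coefs_closed P q.+1 -> dd_ok (allkeys q.+2) ->
  betti P q = Some n -> dim_cohomology (@bracket k) (@supported k P) q.+1 n.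
Proof.
move=> cl cl' ok; rewrite /betti.
case E1: diff_rank => [r1|] //; case E2: diff_rank => [r2|] // [<-].
have := dim_supported char0 cl cl' ok.
by rewrite (rank_diff_mx char0 cl E1) (rank_diff_mx char0 cl' E2).
Qed.

Lemma dim_Hw_betti q (h : int -> nat) : (q == 1)%N || (q == 2)%N ->
  all (fun w => betti_is w q (h (int_of_Z w))) weights ->
  (forall w, ~~ has (BinInt.Z.eqb (Z_of_int w)) weights -> h w = 0%N) ->
  forall w, dim_Hw k q.+1 w (h w).
Proof.
move=> q12 hq h0 w.
apply: (@dim_cohomology_ext _ _ _ (@supported k (has_weight (Z_of_int w)))).
  by move=> p f; apply: iff_sym; exact: supported_weight.
have /and3P[w2 w3 w4] := weight_check; have /andP[d3 d4] := dd_check.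
have cl : diff_coefs_closed (has_weight (Z_of_int w)) q.
  by case/orP: q12 => /eqP->; apply: closed_weight.
have cl' : diff_coefs_closed (has_weight (Z_of_int w)) q.+1.
  by case/orP: q12 => /eqP->; apply: closed_weight.
have ok : dd_ok (allkeys q.+2) by case/orP: q12 => /eqP->.
case: (boolP (has (BinInt.Z.eqb (Z_of_int w)) weights)) => [|nw].
  case/hasP=> z zws /BinInt.Z.eqb_spec e.
  have := betti_isP (allP hq _ zws); rewrite -e Z_of_intK.
  exact: (bettiP cl cl' ok).
(* Outside the window there are no coordinates, and truncated subtraction gives 0 whatever the ranks
   are. *)
have e0 : nkeys (has_weight (Z_of_int w)) q.+1 = 0%N.
  apply/eqP; rewrite /nkeys /keys size_filter -leqn0 leqNgt -has_count.
  apply/hasPn => t tA; apply: contra nw => /BinInt.Z.eqb_spec wE.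
  have /andP[r2 r3] := range_check.
  have ok' : in_range_ok (allkeys q.+1) by case/orP: q12 => /eqP->.
  have /hasP[z zws /BinInt.Z.eqb_spec zE] := allP ok' _ tA.
  apply/hasP; exists z; first exact: zws.
  exact/BinInt.Z.eqb_spec/(etrans (esym wE) zE).
have := dim_supported char0 cl cl' ok.
have n0 r2 r1 : (nkeys (has_weight (Z_of_int w)) q.+1 - r2 - r1)%N = 0%N.
  by rewrite e0 !sub0n.
rewrite n0 (h0 _ nw) => dim0; exact: dim0.
Qed.

Lemma dim_H_betti q n : (q == 1)%N || (q == 2)%N ->
  betti xpredT q = Some n -> dim_H k q.+1 n.
Proof.
move=> q12 hq.
apply: (@dim_cohomology_ext _ _ _ (@supported k xpredT)).
  by move=> p f; split=> [[]|fC] //; split.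
have /andP[d3 d4] := dd_check.
have cl p : diff_coefs_closed xpredT p by apply/allP=> t _; apply/allP.
apply: bettiP (cl _) (cl _) _ hq; by case/orP: q12 => /eqP->.
Qed.

End Final.

Theorem theorem6p4 (k : fieldType) (char0 : [pchar k] =i pred0) :
  ((forall w : int,
      dim_Hw k 2 w
        (if w == - 2%:Z then 19%N
         else if w == - 1%:Z then 26%N
         else if w == 0%:Z then 11%N
         else if w == 1%:Z then 4%N
         else 0%N))
   /\ dim_H k 2 60)
  /\
  ((forall w : int,
      dim_Hw k 3 w
        (if w == - 7%:Z then 34%N
         else if w == - 6%:Z then 60%N
         else if w == - 5%:Z then 62%N
         else if w == - 4%:Z then 39%N
         else if w == - 3%:Z then 12%N
         else if w == - 2%:Z then 2%N
         else 0%N))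
   /\ dim_H k 3 209).
Proof.
have h2 w : ~~ has (BinInt.Z.eqb (Z_of_int w)) weights -> dimH2 w = 0%N.
  (* The weights with a nonzero value all lie in the window, which contradicts the hypothesis by
     computation. *)
  by rewrite /dimH2; do 4! (case: eqP => [->|_]; first by []).
have h3 w : ~~ has (BinInt.Z.eqb (Z_of_int w)) weights -> dimH3 w = 0%N.
  by rewrite /dimH3; do 6! (case: eqP => [->|_]; first by []).
split; split.
- exact: (dim_Hw_betti char0 (q := 1) (h := dimH2) isT betti2 h2).
- exact: (dim_H_betti char0 (q := 1) isT betti_total2).
- exact: (dim_Hw_betti char0 (q := 2) (h := dimH3) isT betti3 h3).
- exact: (dim_H_betti char0 (q := 2) isT betti_total3).
Qed.
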